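(* Let $N=2n$ and let $D_N$ be the double chain on $N$ points. Then the number of non-crossing spanning trees of $D_N$ is $\Omega(12.52^N)$.
   Context: All point sets are in general position (no three points collinear). A geometric graph on a point set $S$ is a graph with vertex set $S$ whose edges are straight-line segments between points of $S$; it is non-crossing if no two edges intersect except at common endpoints. A non-crossing spanning tree of $S$ is a non-crossing geometric graph on $S$ that is a spanning tree. The double chain on $N=2n$ points consists of two sets of $n$ points each, an upper chain forming a convex chain and a lower chain forming a concave chain, such that every straight line through two points of the upper chain leaves all points of the lower chain on the same side, and every straight line through two points of the lower chain leaves all points of the upper chain on the same side. *)

(* Defs.v *)
From HB Require Import structures.
From mathcomp Require Import all_boot all_order all_algebra.
From mathcomp Require Import boolp reals.

Set Implicit Arguments.
Unset Strict Implicit.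
Unset Printing Implicit Defensive.

Import Order.TTheory GRing.Theory Num.Theory.
Local Open Scope ring_scope.

Section Plane.
Variable R : realType.

Definition point := 'rV[R]_2.
Definition xc (a : point) : R := a 0 0.
Definition yc (a : point) : R := a 0 1.

Definition on_line (a b z : point) : Prop :=
  exists t : R, z = (1 - t) *: a + t *: b.

Definition on_segment (a b z : point) : Prop :=
  exists2 t : R, 0 <= t <= 1 & z = (1 - t) *: a + t *: b.

(* Height at abscissa x of the line ab; only meaningful if xc a != xc b. *)
Definition line_height (a b : point) (x : R) : R :=
  yc a + (yc b - yc a) / (xc b - xc a) * (x - xc a).

Definition below_line (a b z : point) : Prop := yc z < line_height a b (xc z).
Definition above_line (a b z : point) : Prop := line_height a b (xc z) < yc z.

(* A finite point set is given as the family p of its points, indexed by a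
   finite type T; graphs on it have vertex type T. *)
Section PointSet.
Variables (T : finType) (p : T -> point).

Definition general_position : Prop :=
  injective p /\
  forall a b c : T, uniq [:: a; b; c] -> ~ on_line (p a) (p b) (p c).

Definition is_graph (E : {set {set T}}) : Prop :=
  forall e, e \in E -> #|e| = 2%N.

Definition adj (E : {set {set T}}) : rel T := fun a b => [set a; b] \in E.

Definition connected_graph (E : {set {set T}}) : Prop :=
  forall a b : T, connect (adj E) a b.

Definition acyclic_graph (E : {set {set T}}) : Prop :=
  forall s : seq T, (3 <= size s)%N -> ~ ucycle (adj E) s.

Definition spanning_tree (E : {set {set T}}) : Prop :=
  [/\ is_graph E, connected_graph E & acyclic_graph E].

Definition on_edge (e : {set T}) (z : point) : Prop :=
  exists a b : T, e = [set a; b] /\ on_segment (p a) (p b) z.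

Definition non_crossing (E : {set {set T}}) : Prop :=
  forall e f : {set T}, e \in E -> f \in E -> e != f ->
  forall z : point, on_edge e z -> on_edge f z ->
  exists2 v : T, v \in e :&: f & z = p v.

Definition nb_nc_spanning_trees : nat :=
  #|[set E : {set {set T}} | `[< spanning_tree E /\ non_crossing E >]]|.

End PointSet.

Section Chains.
Variable n : nat.

Definition x_increasing (u : 'I_n -> point) : Prop :=
  forall i j : 'I_n, (i < j)%N -> xc (u i) < xc (u j).

Definition convex_chain (u : 'I_n -> point) : Prop :=
  x_increasing u /\
  forall i j k : 'I_n, (i < j < k)%N -> below_line (u i) (u k) (u j).

Definition concave_chain (l : 'I_n -> point) : Prop :=
  x_increasing l /\
  forall i j k : 'I_n, (i < j < k)%N -> above_line (l i) (l k) (l j).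

(* inl indexes the upper chain and inr the lower chain, left to right. *)
Definition upper (p : 'I_n + 'I_n -> point) : 'I_n -> point := fun i => p (inl i).
Definition lower (p : 'I_n + 'I_n -> point) : 'I_n -> point := fun i => p (inr i).

(* Asking only that each line leave the other chain on one side, whichever it
   is, would also admit a concave chain lying inside the convex one, i.e. points
   in convex position. The common side is the one that makes the convex chain
   the upper one. *)
Definition double_chain (p : 'I_n + 'I_n -> point) : Prop :=
  [/\ general_position p,
      convex_chain (upper p),
      concave_chain (lower p),
      (forall i j k : 'I_n, (i < j)%N ->
         below_line (upper p i) (upper p j) (lower p k))
    & (forall i j k : 'I_n, (i < j)%N ->
         above_line (lower p i) (lower p j) (upper p k))].

End Chains.
End Plane.

(* Main.v *)
(** The tree is put together from two halves standing side by side, in which the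
    chains exchange their roles; hence only the total number of points of a half
    matters. In a half, take any non-crossing forest W on the first chain, a
    non-crossing forest w on the second chain with one marked root in each
    component, and a monotone lattice path through the pairs (point of the first
    chain, root of w). Following the path, join each new root to the current point
    of the first chain, and join each new point that is the first one of its
    component in W to the current root. Whatever W, w and the path are, this grows
    a plane tree, and different choices give different trees.

    The forests are coded by words obeying algebraic recurrences. The recurrence
    for W has no nonnegative fixed point at 1/8.2, and the one for w with its path
    has none at weight 1/12.53 per point of w and 13/20 per step of the path, so
    the partial sums of both generating functions are unbounded at these values.
    With N steps there are therefore at least c 8.15^N choices of W, while some
    (m, i) admits at least 12.52^(m+1) (12.52/8.15)^i pairs of a forest w on m + 1
    points and a path with i steps; concatenating such pairs gives the growth rate
    12.52 per point. *)

From mathcomp Require Import classical_sets topology normedtype sequences.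
From mathcomp Require Import all_boot all_order all_algebra.
From mathcomp Require Import boolp reals.
From HB Require Import structures.
From mathcomp Require Import zify ring lra.
Require Import Defs.

Set Implicit Arguments.
Unset Strict Implicit.
Unset Printing Implicit Defensive.

Import Order.TTheory GRing.Theory Num.Theory.
Import numFieldNormedType.Exports.

(** * Words and non-crossing forests *)

(* A word describes a non-crossing forest on consecutive points of a chain:
   [Bar t] moves to the next point; [Arc u c t] draws an arc from the current
   point over [u], one slot between consecutive points, then [c], and goes on
   with [t] at its right end; [Root e t] marks the current point.  As [c] is
   required to be barless, the slot after [u] is the last one lying directly
   below the arc: it is what keeps the arc from closing a cycle, and it makes
   the word of a forest unique.  A word of width [m] lives on [m + 1] points.
   The number [e] is the number of steps a lattice path takes along the other
   chain while it stays at this root. *)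
Inductive word :=
  | Eps
  | Bar of word
  | Root of nat & word
  | Arc of word & word & word.

HB.instance Definition _ := gen_eqMixin word.

Fixpoint width w : nat :=
  match w with
  | Eps => 0
  | Bar t => (width t).+1
  | Root _ t => width t
  | Arc u c t => (width u + width c + width t).+1
  end.

Fixpoint steps w : nat :=
  match w with
  | Eps => 0
  | Bar t => steps t
  | Root e t => e + steps t
  | Arc u c t => steps u + steps c + steps t
  end.

Fixpoint arcs j w : seq (nat * nat) :=
  match w with
  | Eps => [::]
  | Bar t => arcs j.+1 t
  | Root _ t => arcs j t
  | Arc u c t =>
      let k := (j + width u).+1 in let q := k + width c in
      (j, q) :: arcs j u ++ arcs k c ++ arcs q t
  end.

(* The points following a [Bar] are the first points of the components other
   than the one of [j]. *)
Fixpoint heads j w : seq nat :=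
  match w with
  | Eps => [::]
  | Bar t => j.+1 :: heads j.+1 t
  | Root _ t => heads j t
  | Arc u c t =>
      let k := (j + width u).+1 in let q := k + width c in
      heads j u ++ heads k c ++ heads q t
  end.

Fixpoint roots j w : seq nat :=
  match w with
  | Eps => [::]
  | Bar t => roots j.+1 t
  | Root _ t => j :: roots j t
  | Arc u c t =>
      let k := (j + width u).+1 in let q := k + width c in
      roots j u ++ roots k c ++ roots q t
  end.

(* The edges between the chains: the path, at position [i] of the other chain,
   joins each root to [i], then joins to this root every point satisfying [h]
   that it steps on.  With [h] the heads of a forest of the other chain, each of
   its components is attached exactly once. *)
Fixpoint rungs (h : pred nat) i j w : seq (nat * nat) :=
  match w with
  | Eps => [::]
  | Bar t => rungs h i j.+1 t
  | Root e t =>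
      (i, j) :: [seq (k, j) | k <- iota i.+1 e & h k] ++ rungs h (i + e) j t
  | Arc u c t =>
      let k := (j + width u).+1 in let q := k + width c in
      rungs h i j u ++ rungs h (i + steps u) k c
        ++ rungs h (i + steps u + steps c) q t
  end.

Fixpoint barless w : bool :=
  match w with
  | Eps => true
  | Bar _ => false
  | Root _ t => barless t
  | Arc _ _ t => barless t
  end.

(* Whether the component of the first point contains a root of [w]. *)
Fixpoint rooted w : bool :=
  match w with
  | Eps => false
  | Bar _ => false
  | Root _ _ => true
  | Arc u _ t => rooted u || rooted t
  end.

Definition starts_with_root w := if w is Root _ _ then true else false.

(* The first point of [u] is also the left end of the arc and the last point of
   [c] its right end; a root there is written outside of the arc. *)
Fixpoint wf w : bool :=
  match w with
  | Eps => true
  | Bar t => wf t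
  | Root _ t => wf t && ~~ starts_with_root t
  | Arc u c t =>
     [&& wf u, ~~ starts_with_root u, wf c, barless c, ~~ rooted c & wf t]
  end.

Lemma arcs_range j w (x : nat * nat) : x \in arcs j w ->
  [/\ j <= x.1, x.1 < x.2 & x.2 <= j + width w].
Proof.
elim: w j => [|t IH|e t IH|u IHu c IHc t IHt] j //=.
- by move=> /IH [*]; split; lia.
- by move=> /IH [*]; split; lia.
- rewrite inE !mem_cat => /or4P [/eqP -> /=|/IHu [*]|/IHc [*]|/IHt [*]];
    split; lia.
Qed.

(** Two arcs over a chain in convex position cross exactly when this fails. *)
Definition laminar (x y : nat * nat) :=
  [|| x.2 <= y.1, y.2 <= x.1, (x.1 <= y.1) && (y.2 <= x.2)
    | (y.1 <= x.1) && (x.2 <= y.2)].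

Lemma laminarC x y : laminar x y = laminar y x.
Proof. by rewrite /laminar orbCA; congr [|| _, _ | _]; rewrite orbC. Qed.

Lemma arcs_laminar j w : {in arcs j w &, forall x y : nat * nat, laminar x y}.
Proof.
elim: w j => [|t IH|e t IH|u IHu c IHc t IHt] j //= x y; try exact: IH.
have rg z : z \in (j, (j + width u).+1 + width c) :: arcs j u ++
     arcs (j + width u).+1 c ++ arcs ((j + width u).+1 + width c) t ->
  [\/ z = (j, (j + width u).+1 + width c), z \in arcs j u,
      z \in arcs (j + width u).+1 c
    | z \in arcs ((j + width u).+1 + width c) t].
  by rewrite inE !mem_cat => /or4P [/eqP|||] ?; constructor.
move=> /rg Hx /rg Hy; rewrite /laminar.
case: Hx => [->|Hx|Hx|Hx]; try move: (arcs_range Hx) => [*];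
case: Hy => [->|Hy|Hy|Hy] /=; try move: (arcs_range Hy) => [*];
  first [exact: IHu Hx Hy|exact: IHc Hx Hy|exact: IHt Hx Hy|lia].
Qed.

(** An arc covers every slot between its ends, so only a top-level [Bar] leaves a slot uncovered. *)
Lemma arcs_cover j w k : barless w -> j <= k < j + width w ->
  exists2 x : nat * nat, x \in arcs j w & x.1 <= k < x.2.
Proof.
elim: w j => [|t IH|e t IH|u _ c _ t IHt] j //=; [lia| |].
  by move=> /IH H /H.
move=> bt kt; case: (ltnP k ((j + width u).+1 + width c)) => kq.
  by exists (j, (j + width u).+1 + width c); rewrite ?inE ?eqxx //=; lia.
have [|x xt xk] := IHt ((j + width u).+1 + width c) bt; first by lia.
by exists x => //; rewrite inE !mem_cat xt !orbT.
Qed.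

Lemma rungs_range h i j w (x : nat * nat) : x \in rungs h i j w ->
  [/\ i <= x.1, x.1 <= i + steps w, j <= x.2 & x.2 <= j + width w].
Proof.
elim: w i j => [|t IH|e t IH|u IHu c IHc t IHt] i j //=.
- by move=> /IH [*]; split; lia.
- rewrite inE mem_cat => /or3P [/eqP -> /=|/mapP [k]|/IH [*]]; try by split; lia.
  by rewrite mem_filter mem_iota => /andP [_ kr] -> /=; split; lia.
- by rewrite !mem_cat => /or3P [/IHu [*]|/IHc [*]|/IHt [*]]; split; lia.
Qed.

Lemma rungs_after h i j w (x : nat * nat) : wf w -> ~~ starts_with_root w ->
  x \in rungs h i j w -> j < x.2.
Proof.
elim: w i j => [|t IH|e t IH|u IHu c IHc t IHt] i j //=.
  by move=> _ _ /rungs_range []; lia.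
case/and5P => wu nu wc bc /andP [rc wt] _.
rewrite !mem_cat => /or3P [/(IHu _ _ wu nu)|/rungs_range []|/rungs_range []]; lia.
Qed.

(** The top-level arcs of a barless word connect its two ends, so a root at its last point would
    make it rooted. This separates the rungs of [c] from those of the [t] that starts at the same
    point. *)
Lemma rungs_before h i j w (x : nat * nat) : wf w -> barless w -> ~~ rooted w ->
  x \in rungs h i j w -> x.2 < j + width w.
Proof.
elim: w i j => [|t IH|e t IH|u IHu c IHc t IHt] i j //=.
case/and5P => wu nu wc bc /andP [rc wt] bt; rewrite negb_or => /andP [ru rt].
rewrite !mem_cat.
move=> /or3P [/rungs_range []|/(IHc _ _ wc bc rc)|/(IHt _ _ wt bt rt)]; lia.
Qed.

Definition le2 (x y : nat * nat) := (x.1 <= y.1) && (x.2 <= y.2).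

(** The path never moves backwards on either chain; this monotonicity is what keeps the rungs from
    crossing. *)
Lemma rungs_chain h i j w :
  {in rungs h i j w &, forall x y : nat * nat, le2 x y || le2 y x}.
Proof.
elim: w i j => [|t IH|e t IH|u IHu c IHc t IHt] i j x y /=; [by []|exact: IH| |].
- rewrite !inE !mem_cat.
  have rg (z : nat * nat) : [|| z == (i, j),
      z \in [seq (k, j) | k <- iota i.+1 e & h k] | z \in rungs h (i + e) j t] ->
     (z.2 = j /\ z.1 <= i + e) \/ z \in rungs h (i + e) j t.
    case/or3P => [/eqP ->|/mapP [k]|]; [by left => /=; lia| |by right].
    by rewrite mem_filter mem_iota => /andP [_ kr] -> /=; left; lia.
  move=> /rg [] Hx /rg [] Hy; rewrite /le2; [lia| | |exact: IH Hx Hy].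
  + by move: (rungs_range Hy) => [*]; lia.
  + by move: (rungs_range Hx) => [*]; lia.
- rewrite !mem_cat => /or3P [] Hx /or3P [] Hy;
    move: (rungs_range Hx) (rungs_range Hy) => [? ? ? ?] [? ? ? ?];
    first [exact: IHu Hx Hy|exact: IHc Hx Hy|exact: IHt Hx Hy|rewrite /le2; lia].
Qed.

(** * Recovering a word from its arcs and rungs *)

Lemma eq_mem_split (T : eqType) (P : pred T) (s t s' t' : seq T) :
    all P s -> all P s' -> all (predC P) t -> all (predC P) t' ->
    s ++ t =i s' ++ t' -> s =i s' /\ t =i t'.
Proof.
move=> Ps Ps' Pt Pt' E.
have f : filter P s = s /\ filter P t = [::].
  split; first exact/all_filterP.
  by apply/eqP; rewrite -(negbK (_ == _)) -has_filter -all_predC.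
have f' : filter P s' = s' /\ filter P t' = [::].
  split; first exact/all_filterP.
  by apply/eqP; rewrite -(negbK (_ == _)) -has_filter -all_predC.
have g : filter (predC P) s = [::] /\ filter (predC P) s' = [::].
  split; apply/eqP; rewrite -(negbK (_ == _)) -has_filter has_predC negbK //.
have g' : filter (predC P) t = t /\ filter (predC P) t' = t'.
  by split; exact/all_filterP.
split=> x.
- by move: (E x); have := mem_filter P x (s ++ t); have := mem_filter P x (s' ++ t');
  rewrite !filter_cat f.1 f.2 f'.1 f'.2 !cats0 => -> -> ->.
- by move: (E x); have := mem_filter (predC P) x (s ++ t);
  have := mem_filter (predC P) x (s' ++ t');
  rewrite !filter_cat g.1 g.2 g'.1 g'.2 /= => -> -> ->.
Qed.

(** The slot after [u2] lies under no arc of the second union. Were [u1] narrower than [u2], this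
    slot would be in the range of the barless [c1], hence covered. *)
Lemma arc_slot_le j u1 c1 u2 c2 :
  width u1 + width c1 = width u2 + width c2 -> barless c1 ->
  arcs j u1 ++ arcs (j + width u1).+1 c1
    =i arcs j u2 ++ arcs (j + width u2).+1 c2 ->
  width u2 <= width u1.
Proof.
move=> wE bc E; rewrite leqNgt; apply/negP => lt.
have [|x xc xk] := @arcs_cover (j + width u1).+1 c1 (j + width u2) bc; first lia.
have : x \in arcs j u2 ++ arcs (j + width u2).+1 c2 by rewrite -E mem_cat xc orbT.
by rewrite mem_cat => /orP [] /arcs_range [*]; lia.
Qed.

(** The arc of the top constructor is the longest one starting at [j], so the set of arcs determines
    its right end. *)
Lemma first_arc_le j u c t u' c' t' :
  arcs j (Arc u c t) =i arcs j (Arc u' c' t') ->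
  width u + width c <= width u' + width c'.
Proof.
move=> /(_ (j, (j + width u).+1 + width c)); rewrite inE eqxx => /esym.
rewrite inE !mem_cat => /or4P [/eqP/pair_equal_spec []|||];
  try move=> /arcs_range []; rewrite /=; lia.
Qed.

Lemma arcs_inside j u c t q : (j + width u).+1 + width c = q ->
  all (fun x : nat * nat => (x.2 <= q) && (x != (j, q)))
    (arcs j u ++ arcs (j + width u).+1 c) /\
  all (predC (fun x : nat * nat => (x.2 <= q) && (x != (j, q))))
    ((j, q) :: arcs q t).
Proof.
move=> E; split; apply/allP => -[a b]; rewrite /= xpair_eqE.
  by rewrite mem_cat => /orP [] /arcs_range [/=]; lia.
by rewrite inE xpair_eqE => /orP [|/arcs_range [/=]]; lia.
Qed.

Lemma arcs_halves j u c p : width u = p ->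
  all (fun x : nat * nat => x.2 <= j + p) (arcs j u) /\
  all (predC (fun x : nat * nat => x.2 <= j + p)) (arcs (j + p).+1 c).
Proof.
by move=> E; split; apply/allP => x /arcs_range [/=]; lia.
Qed.

Lemma arcs_split j u1 c1 t1 u2 c2 t2 : barless c1 -> barless c2 ->
  arcs j (Arc u1 c1 t1) =i arcs j (Arc u2 c2 t2) ->
  let k := (j + width u1).+1 in let q := k + width c1 in
  [/\ width u1 = width u2, width c1 = width c2, arcs j u1 =i arcs j u2,
      arcs k c1 =i arcs k c2 & arcs q t1 =i arcs q t2].
Proof.
move=> bc1 bc2 A.
have qE : width u1 + width c1 = width u2 + width c2.
  by apply/eqP; rewrite eqn_leq (first_arc_le A) (first_arc_le (fsym A)).
move: A => /=; set q := (j + width u1).+1 + width c1.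
have -> : (j + width u2).+1 + width c2 = q by rewrite /q; lia.
move=> A.
have [lo1 hi1] := @arcs_inside j u1 c1 t1 q erefl.
have [|lo2 hi2] := @arcs_inside j u2 c2 t2 q; first by rewrite /q; lia.
have [|Auc At] := eq_mem_split lo1 lo2 hi1 hi2.
  move=> x; move: (A x); rewrite !inE !mem_cat !inE.
  by case: (x == (j, q)); rewrite ?orbT //= -!orbA.
have uE : width u1 = width u2.
  by apply/eqP; rewrite eqn_leq (arc_slot_le _ bc1 Auc) // (arc_slot_le _ bc2 (fsym Auc)).
rewrite -uE in Auc *.
have [su1 sc1] := @arcs_halves j u1 c1 _ erefl.
have [su2 sc2] := @arcs_halves j u2 c2 _ (esym uE).
have [Au Ac] := eq_mem_split su1 su2 sc1 sc2 Auc.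
split=> //; first by apply/eqP; move: qE => /eqP; rewrite uE eqn_add2l.
(* Equality of sets forgets multiplicities; [(j, q)] can be removed from both sides because the arcs
   of the last parts start at [q > j]. *)
have jq : j < q by rewrite /q addSn ltnS -addnA leq_addr.
have f t x : x \in arcs q t -> (x == (j, q)) = false.
  case: x => a b /arcs_range /= [qa _ _]; apply/negbTE; rewrite xpair_eqE.
  by rewrite gtn_eqF // (leq_trans jq qa).
move=> x; move: (At x); rewrite !inE.
by case: eqVneq => //= -> _; apply/idP/idP => /f; rewrite eqxx.
Qed.

Lemma rungs_split h i1 i2 j u1 c1 t1 u2 c2 t2 :
  wf (Arc u1 c1 t1) -> wf (Arc u2 c2 t2) ->
  width u1 = width u2 -> width c1 = width c2 ->
  rungs h i1 j (Arc u1 c1 t1) =i rungs h i2 j (Arc u2 c2 t2) ->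
  let k := (j + width u1).+1 in let q := k + width c1 in
  [/\ rungs h i1 j u1 =i rungs h i2 j u2,
      rungs h (i1 + steps u1) k c1 =i rungs h (i2 + steps u2) k c2
    & rungs h (i1 + steps u1 + steps c1) q t1
        =i rungs h (i2 + steps u2 + steps c2) q t2].
Proof.
move=> /= W1 W2 uE cE; rewrite -uE -cE.
set k := (j + width u1).+1; set q := k + width c1; rewrite !catA => R.
have lo i i' u c : [&& wf c, barless c & ~~ rooted c] ->
    width u = width u1 -> width c = width c1 ->
    all (fun x : nat * nat => x.2 < q) (rungs h i j u ++ rungs h i' k c).
  move=> /and3P [wc bc rc] uE' cE'; apply/allP => x; rewrite mem_cat.
  move=> /orP [/rungs_range [_ _ _]|/(rungs_before wc bc rc)].
    by rewrite /q /k uE' => H; apply: leq_trans (leq_addr _ _); rewrite ltnS.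
  by rewrite cE'.
have hi i t : all (predC (fun x : nat * nat => x.2 < q)) (rungs h i q t).
  by apply/allP => x /rungs_range [_ _ ? _]; rewrite /= -leqNgt.
have W u c t : wf (Arc u c t) -> [&& wf c, barless c & ~~ rooted c].
  by case/and5P => _ _ wc bc /andP [rc _]; apply/and3P.
have [Ruc Rt] := eq_mem_split
  (lo i1 (i1 + steps u1) _ _ (W _ _ _ W1) erefl erefl)
  (lo i2 (i2 + steps u2) _ _ (W _ _ _ W2) (esym uE) (esym cE))
  (hi _ _) (hi _ _) R.
have lo' i u : width u = width u1 ->
    all (fun x : nat * nat => x.2 < k) (rungs h i j u).
  by move=> E; apply/allP => x /rungs_range [_ _ _]; rewrite E /k ltnS.
have hi' i c : all (predC (fun x : nat * nat => x.2 < k)) (rungs h i k c).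
  by apply/allP => x /rungs_range [_ _ ? _]; rewrite /= -leqNgt.
by have [] := eq_mem_split (lo' _ _ erefl) (lo' _ _ (esym uE)) (hi' _ _)
  (hi' _ _) Ruc.
Qed.

(* Steps that reach no head leave no edge, so the position of the path inside a
   word is only known at its end: the comparison runs from right to left, and
   the equality of the starting positions is part of the conclusion. *)
Lemma word_inj h w1 w2 i1 i2 j : wf w1 -> wf w2 -> width w1 = width w2 ->
  arcs j w1 =i arcs j w2 -> rungs h i1 j w1 =i rungs h i2 j w2 ->
  i1 + steps w1 = i2 + steps w2 -> i1 = i2 /\ w1 = w2.
Proof.
elim: w1 w2 i1 i2 j => [|t1 IH|e1 t1 IH|u1 IHu c1 IHc t1 IHt] w2 i1 i2 j.
- case: w2 => [|t2|e2 t2|u2 c2 t2] //= _ _ _ _ R; first by move=> sE; split=> //; lia.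
  by move: (R (i2, j)); rewrite !inE eqxx.
- case: w2 => [|t2|e2 t2|u2 c2 t2] //=.
  + by move=> w1 w2 [wE] A R sE; have [-> ->] := IH t2 i1 i2 j.+1 w1 w2 wE A R sE.
  + move=> _ _ _ _ R _; move: (R (i2, j)); rewrite !inE eqxx => /rungs_range /= [*]; lia.
  + move=> _ _ _ A _ _; have := A (j, (j + width u2).+1 + width c2).
    by rewrite inE eqxx => /arcs_range /= [*]; lia.
- case: (boolP (starts_with_root w2)) => [|nr]; last first.
    move=> _ w2w _ _ R _; have := R (i1, j); rewrite inE eqxx => /esym.
    by move=> /(rungs_after w2w nr) /=; lia.
  case: w2 => [|t2|e2 t2|u2 c2 t2] //= _ /andP [w1 n1] /andP [w2 n2] wE A R sE.
  (* The least position among the rungs at [j] is where the path arrives, so equal rungs give equal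
     starting positions. *)
  have lt i0 i e t : wf t -> ~~ starts_with_root t -> 
      (i0, j) \in rungs h i j (Root e t) -> i <= i0.
    move=> wt nt; rewrite inE mem_cat => /or3P [/eqP [->]|/mapP [k]|] //.
      by rewrite mem_filter mem_iota => /andP [_ kr] [->]; lia.
    by move=> /(rungs_after wt nt) /=; lia.
  have iE : i1 = i2.
    apply/eqP; rewrite eqn_leq; apply/andP; split.
      by apply: (lt i2 i1 e1 t1) => //; rewrite /= R inE eqxx.
    by apply: (lt i1 i2 e2 t2) => //; rewrite /= -R inE eqxx.
  rewrite {}iE {lt} in R sE *; split=> //.
  have lo i e : all (fun x : nat * nat => x.2 <= j)
     ((i, j) :: [seq (k, j) | k <- iota i.+1 e & h k]).
    by apply/allP => x; rewrite inE => /predU1P [-> //=|/mapP [k _ ->] /=].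
  have hi i t : wf t -> ~~ starts_with_root t ->
      all (predC (fun x : nat * nat => x.2 <= j)) (rungs h i j t).
    by move=> wt nt; apply/allP => x /(rungs_after wt nt) /=; lia.
  have [] := eq_mem_split (lo i2 e1) (lo i2 e2)
    (hi (i2 + e1) t1 w1 n1) (hi (i2 + e2) t2 w2 n2) R.
  move=> _ R'; have [|eE ->] := IH t2 (i2 + e1) (i2 + e2) j w1 w2 wE A R'; first lia.
  by congr Root; lia.
- case: w2 => [|t2|e2 t2|u2 c2 t2] //.
  + move=> _ _ _ /= A _ _; have := A (j, (j + width u1).+1 + width c1).
    by rewrite inE eqxx => /esym /arcs_range /= [*]; lia.
  + move=> w1 _ _ _ R _; have := R (i2, j); rewrite [X in _ = X]inE eqxx.
    by move=> /(rungs_after w1 isT) /=; rewrite ltnn.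
  move=> W1 W2 wE A R sE.
  case/and5P: (W1) => wu1 _ wc1 bc1 /andP [_ wt1].
  case/and5P: (W2) => wu2 _ wc2 bc2 /andP [_ wt2].
  have [uE cE Au Ac At] := arcs_split bc1 bc2 A.
  have [Ru Rc Rt] := rungs_split W1 W2 uE cE R.
  have tE : width t1 = width t2.
    by apply/eqP; move: wE => /= /eqP; rewrite eqSS uE cE eqn_add2l.
  have [|sE' <-] := IHt _ _ _ _ wt1 wt2 tE At Rt.
    by move: sE => /=; rewrite !addnA.
  have [sE'' <-] := IHc _ _ _ _ wc1 wc2 cE Ac Rc sE'.
  by have [-> <-] := IHu _ _ _ _ wu1 wu2 uE Au Ru sE''.
Qed.

(** * The two classes of words used in a half, and their edge counts *)

Fixpoint rootless w : bool :=
  match w with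
  | Eps => true
  | Bar t => rootless t
  | Root _ _ => false
  | Arc u c t => [&& rootless u, rootless c, barless c & rootless t]
  end.

(* Every component has exactly one root, except possibly that of the first
   point, which then has none.  Keeping the roots out of the component of [c]
   loses some forests but shortens the recurrences. *)
Fixpoint one_root w : bool :=
  match w with
  | Eps => true
  | Bar t => one_root t && rooted t
  | Root _ t => one_root t && ~~ rooted t
  | Arc u c t =>
     [&& one_root u, ~~ starts_with_root u, one_root c, barless c,
         ~~ rooted c, one_root t & ~~ (rooted u && rooted t)]
  end.

Lemma rootless_unrooted w : rootless w -> ~~ rooted w.
Proof.
elim: w => [|t IH|e t IH|u IHu c IHc t IHt] //=.
by case/and4P => /IHu ru _ _ /IHt rt; rewrite negb_or ru.
Qed.

Lemma unrooted_start w : ~~ rooted w -> ~~ starts_with_root w.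
Proof. by case: w. Qed.

Lemma rootless_wf w : rootless w -> wf w.
Proof.
elim: w => [|t IH|e t IH|u IHu c IHc t IHt] //= /and4P [ru rc bc rt].
rewrite IHu // IHc // IHt // bc rootless_unrooted //.
by rewrite unrooted_start // rootless_unrooted.
Qed.

Lemma one_root_wf w : one_root w -> wf w.
Proof.
elim: w => [|t IH|e t IH|u IHu c IHc t IHt] //=.
- by case/andP => /IH.
- by case/andP => /IH -> /unrooted_start.
- by case/and5P => /IHu -> -> /IHc -> -> /and3P [-> /IHt -> _].
Qed.

Lemma rootless_rungs h i j w : rootless w -> rungs h i j w = [::].
Proof.
elim: w i j => [|t IH|e t IH|u IHu c IHc t IHt] i j //=; first exact: IH.
by case/and4P => ru rc _ rt; rewrite IHu // IHc // IHt.
Qed.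

Lemma rootless_steps w : rootless w -> steps w = 0.
Proof.
elim: w => [|t IH|e t IH|u IHu c IHc t IHt] //=.
by case/and4P => ru rc _ rt; rewrite IHu // IHc // IHt.
Qed.

(** Each slot contributes either one arc or one new component. *)
Lemma size_arcs_heads j w : size (arcs j w) + size (heads j w) = width w.
Proof.
elim: w j => [|t IH|e t IH|u IHu c IHc t IHt] j //=.
- by rewrite addnS IH.
- rewrite !size_cat; have := IHu j; have := IHc (j + width u).+1.
  have := IHt ((j + width u).+1 + width c); lia.
Qed.

(** The components counted by [heads] have one root each; [rooted] accounts for the remaining
    component, that of the first point. *)
Lemma size_roots j w : one_root w ->
  size (roots j w) = size (heads j w) + rooted w.
Proof.
elim: w j => [|t IH|e t IH|u IHu c IHc t IHt] j //=.
- by case/andP => wt rt; rewrite IH // rt addn1 addn0.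
- by case/andP => wt rt; rewrite IH // (negbTE rt) addn0 addn1.
- case/and5P => wu _ wc _ /and3P [rc wt ut].
  rewrite !size_cat IHu // IHc // IHt // (negbTE rc).
  by move: ut; case: (rooted u); case: (rooted t) => //= _;
    rewrite ?addn0 ?addn1 ?addSn ?addnS ?addnA.
Qed.

Lemma size_rungs h i j w :
  size (rungs h i j w) = size (roots j w) + count h (iota i.+1 (steps w)).
Proof.
elim: w i j => [|t IH|e t IH|u IHu c IHc t IHt] i j //=.
- rewrite iotaD count_cat size_cat size_map size_filter IH !addSn; congr _.+1; exact: addnCA.
- rewrite !iotaD !count_cat !size_cat IHu IHc IHt !addSn !addnA; lia.
Qed.

Lemma heads_range j w k : k \in heads j w -> j < k <= j + width w.
Proof.
elim: w j => [|t IH|e t IH|u IHu c IHc t IHt] j //=.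
- by rewrite inE => /orP [/eqP ->|/IH]; lia.
- exact: IH.
- by rewrite !mem_cat => /or3P [/IHu|/IHc|/IHt]; lia.
Qed.

(** * Connectedness of a half, for an abstract equivalence relation *)

Section Joined.
Variable R : nat -> nat -> Prop.
Hypothesis Rxx : forall a, R a a.
Hypothesis Rsym : forall a b, R a b -> R b a.
Hypothesis Rtrans : forall a b c, R a b -> R b c -> R a c.

Definition joins j w := forall x, x \in arcs j w -> R x.1 x.2.

Lemma joins_arc j u c t : joins j (Arc u c t) ->
  let k := (j + width u).+1 in let q := k + width c in
  [/\ R j q, joins j u, joins k c & joins q t].
Proof.
move=> H; split=> [|x xu|x xc|x xt]; last 3 first.
- by apply: H; rewrite inE mem_cat xu orbT.
- by apply: H; rewrite inE !mem_cat xc !orbT.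
- by apply: H; rewrite inE !mem_cat xt !orbT.
- by apply: (H (_, _)); rewrite inE eqxx.
Qed.

Lemma barless_joined j w : wf w -> barless w -> joins j w ->
  R j (j + width w).
Proof.
elim: w j => [|t IH|e t IH|u IHu c IHc t IHt] j //=.
- by rewrite addn0.
- by case/andP => wt _ bt; apply: IH.
- case/and5P => _ _ wc bc /andP [_ wt] bt /joins_arc /= [jq _ _ Ht].
  have -> : j + (width u + width c + width t).+1 =
     (j + width u).+1 + width c + width t by lia.
  exact: Rtrans jq (IHt _ wt bt Ht).
Qed.

(** The bound [h <= k] lets a walk from left to right treat each point after the first as a head or
    as linked to an earlier point. *)
Lemma joined_head j w k : wf w -> joins j w -> j <= k <= j + width w ->
  R k j \/ exists2 h, h \in heads j w & h <= k /\ R k h.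
Proof.
elim: w j => [|t IH|e t IH|u IHu c IHc t IHt] j //=.
- by move=> _ _ jk; left; have -> : k = j by lia.
- move=> wt Ht jk; case: (ltnP j k) => kj; last first.
    by left; have -> : k = j by lia.
  have [|H|[h hh hk]] := IH j.+1 wt Ht; first lia.
    by right; exists j.+1; rewrite ?inE ?eqxx.
  by right; exists h; rewrite ?inE ?hh ?orbT.
- by case/andP => wt _; exact: IH.
- move=> /and5P [wu _ wc bc /andP [_ wt]] /joins_arc /= [jq Hu Hc Ht] jk.
  have cq := barless_joined wc bc Hc.
  case: (leqP k (j + width u)) => [ku|uk].
    have [|H|[h hh hk]] := IHu j wu Hu; [lia|by left|].
    by right; exists h; rewrite // mem_cat hh.
  case: (leqP k ((j + width u).+1 + width c)) => [kc|ck].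
    have [|H|[h hh hk]] := IHc _ wc Hc; [lia| |].
      by left; apply: Rtrans H _; apply: Rtrans cq (Rsym jq).
    by right; exists h; rewrite // !mem_cat hh orbT.
  have [|H|[h hh hk]] := IHt _ wt Ht; [lia| |].
    by left; apply: Rtrans H (Rsym jq).
  by right; exists h; rewrite // !mem_cat hh !orbT.
Qed.

(** The claims go together: the first supplies the root of a component opened by a [Bar], which the
    second needs. *)
Lemma joined_root j w : one_root w -> joins j w ->
  (rooted w -> exists2 r, r \in roots j w & R j r) /\
  forall k, j <= k <= j + width w ->
    R k j \/ exists2 r, r \in roots j w & R k r.
Proof.
elim: w j => [|t IH|e t IH|u IHu c IHc t IHt] j //=.
- by move=> _ _; split=> // k jk; left; have -> : k = j by lia.
- move=> /andP [wt rt] Ht; split=> // k jk.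
  have [/(_ rt) [r rr Rr] H] := IH _ wt Ht.
  case: (ltnP j k) => kj; last by left; have -> : k = j by lia.
  right; have [|Rk|[s sr Rs]] := H k; [lia| |by exists s].
  by exists r => //; apply: Rtrans Rk Rr.
- move=> /andP [wt rt] Ht; split=> [_|k jk]; first by exists j; rewrite ?inE ?eqxx.
  have [_ /(_ k jk) [|[s sr Rs]]] := IH _ wt Ht; first by left.
  by right; exists s; rewrite // inE sr orbT.
- move=> /and5P [wu nu wc bc /and3P [rc wt ut]] /joins_arc /= [jq Hu Hc Ht].
  have cq := barless_joined (one_root_wf wc) bc Hc.
  have [u1 u2] := IHu _ wu Hu; have [_ c2] := IHc _ wc Hc.
  have [t1 t2] := IHt _ wt Ht; split=> [/orP [/u1|/t1] [r rr Rr]|k jk].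
  + by exists r; rewrite // mem_cat rr.
  + by exists r; [rewrite !mem_cat rr !orbT|apply: Rtrans jq Rr].
  case: (leqP k (j + width u)) => [ku|uk].
    have [|H|[h hh hk]] := u2 k; [lia|by left|].
    by right; exists h; rewrite // mem_cat hh.
  case: (leqP k ((j + width u).+1 + width c)) => [kc|ck].
    have [|H|[h hh hk]] := c2 k; [lia| |].
      by left; apply: Rtrans H _; apply: Rtrans cq (Rsym jq).
    by right; exists h; rewrite // !mem_cat hh orbT.
  have [|H|[h hh hk]] := t2 k; [lia| |].
    by left; apply: Rtrans H (Rsym jq).
  by right; exists h; rewrite // !mem_cat hh !orbT.
Qed.

End Joined.

Section Traverse.
Variables (T : Type) (C : T -> T -> Prop) (up lo : nat -> T).
Hypothesis Cxx : forall a, C a a.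
Hypothesis Csym : forall a b, C a b -> C b a.
Hypothesis Ctrans : forall a b c, C a b -> C b c -> C a c.

(** Invariant of the walk: the points met so far, from [i0] on, are linked to [b]. A point stepped
    on is linked through the current root if [h] holds there, and through an earlier point
    otherwise. *)
Lemma rungs_joined (h : pred nat) i0 i j w (b : T) :
  (forall x, x \in rungs h i j w -> C (up x.1) (lo x.2)) -> i0 <= i ->
  (forall k, i0 <= k <= i -> C (up k) b) ->
  (forall k, i < k <= i + steps w ->
     h k \/ exists2 k', i0 <= k' < k & C (up k) (up k')) ->
  (forall k, i0 <= k <= i + steps w -> C (up k) b) /\
  (forall r, r \in roots j w -> C (lo r) b).
Proof.
elim: w i j => [|t IH|e t IH|u IHu c IHc t IHt] i j /= Hr i0i Hi Hh.
- by rewrite addn0.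
- exact: IH.
- have jb : C (lo j) b.
    apply: Ctrans (Hi i _); last by rewrite i0i leqnn.
    by apply: Csym; apply: (Hr (_, _)); rewrite inE eqxx.
  have He : forall k, i0 <= k <= i + e -> C (up k) b.
    (* The induction is strong because [k'] may itself be one of the points just stepped on. *)
    elim/ltn_ind => k IHk /andP [ik ke].
    case: (leqP k i) => ki; first by apply: Hi; rewrite ik.
    have [|hk|[k' /andP [ik' kk'] Ck]] := Hh k; [lia| |].
      apply: Ctrans jb; apply: (Hr (_, _)).
      rewrite inE mem_cat; apply/orP; right; apply/orP; left.
      by apply/mapP; exists k; rewrite // mem_filter hk mem_iota; lia.
    apply: Ctrans Ck (IHk _ kk' _); lia.
  have [||||H1 H2] := IH (i + e) j.
  + by move=> x xt; apply: Hr; rewrite inE mem_cat xt !orbT.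
  + by apply: leq_trans i0i (leq_addr _ _).
  + exact: He.
  + by move=> k ke; apply: Hh; lia.
  split; first by rewrite addnA.
  by move=> r; rewrite inE => /predU1P [->|/H2].
- have [||H1 H2] := IHu i j _ i0i Hi.
  + by move=> x xu; apply: Hr; rewrite mem_cat xu.
  + by move=> k ke; apply: Hh; lia.
  have [|||H3 H4] := IHc (i + steps u) (j + width u).+1 _ _ H1.
  + by move=> x xu; apply: Hr; rewrite !mem_cat xu orbT.
  + by apply: leq_trans i0i (leq_addr _ _).
  + by move=> k ke; apply: Hh; lia.
  have [|||H5 H6] := IHt (i + steps u + steps c) ((j + width u).+1 + width c) _ _ H3.
  + by move=> x xu; apply: Hr; rewrite !mem_cat xu !orbT.
  + by rewrite -addnA; apply: leq_trans i0i (leq_addr _ _).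
  + by move=> k ke; apply: Hh; lia.
  split; first by rewrite !addnA.
  by move=> r; rewrite !mem_cat => /or3P [/H2|/H4|/H6].
Qed.


Lemma half_joined i0 j0 W w :
  rootless W -> one_root w -> rooted w -> width W = steps w ->
  (forall x, x \in arcs i0 W -> C (up x.1) (up x.2)) ->
  (forall x, x \in arcs j0 w -> C (lo x.1) (lo x.2)) ->
  (forall x, x \in rungs [in heads i0 W] i0 j0 w -> C (up x.1) (lo x.2)) ->
  (forall k, i0 <= k <= i0 + width W -> C (up k) (up i0)) /\
  (forall k, j0 <= k <= j0 + width w -> C (lo k) (up i0)).
Proof.
move=> rW ww rw wE HW Hw Hr.
have [|k ki|k ki|H1 H2] := @rungs_joined [in heads i0 W] i0 i0 j0 w (up i0) Hr.
- exact: leqnn.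
- by have -> : k = i0 by lia.
- have [||||Ck|[h hh [hk Ck]]] := @joined_head (fun a b => C (up a) (up b))
    _ _ _ i0 W k (rootless_wf rW) HW.
  + by move=> a.
  + by move=> a b; apply: Csym.
  + by move=> a b c; apply: Ctrans.
  + lia.
  + by right; exists i0 => //; lia.
  have := heads_range hh; case: (ltngtP h k) hk => // [hk _|hk _] hr.
    by right; exists h => //; lia.
  by left; rewrite -hk.
split; first by move=> k ki; apply: H1; lia.
have [|||H3 H4] := @joined_root (fun a b => C (lo a) (lo b))
  _ _ _ j0 w ww Hw.
- by move=> a.
- by move=> a b; apply: Csym.
- by move=> a b c; apply: Ctrans.
move=> k kj; have [Ck|[r rr Cr]] := H4 k kj.
  by have [r rr Cr] := H3 rw; apply: Ctrans Ck (Ctrans Cr (H2 _ rr)).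
exact: Ctrans Cr (H2 _ rr).
Qed.

End Traverse.

(** The bound is one less than the [width W + width w + 2] points of the half. With connectedness,
    such a count replaces a direct proof of acyclicity. *)
Lemma size_half i j W w : one_root w -> rooted w ->
  size (arcs i W) + size (arcs j w) + size (rungs [in heads i W] i j w)
  <= width W + width w + 1.
Proof.
move=> ww rw; rewrite size_rungs size_roots // rw !addn1.
set m := count _ _; have : m <= size (heads i W).
  rewrite /m -size_filter; apply: uniq_leq_size; first by rewrite filter_uniq ?iota_uniq.
  by move=> x; rewrite mem_filter => /andP [].
have := size_arcs_heads i W; have := size_arcs_heads j w; lia.
Qed.

(** * Crossings of segments *)

Section Orientation.
Variable R : realType.
Local Open Scope ring_scope.
Implicit Types a b c d z : point R.

(** Twice the signed area of the triangle, positive for a counterclockwise turn. *)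
Definition orient a b c : R :=
  (xc b - xc a) * (yc c - yc a) - (yc b - yc a) * (xc c - xc a).

Lemma orientC a b c : orient a c b = - orient a b c.
Proof. by rewrite /orient; ring. Qed.

Lemma orient_swap a b c : orient b a c = - orient a b c.
Proof. by rewrite /orient; ring. Qed.

Lemma orient_cycle a b c : orient b c a = orient a b c.
Proof. by rewrite /orient; ring. Qed.

Lemma orient_affine a b c d t :
  orient a b ((1 - t) *: c + t *: d) =
  (1 - t) * orient a b c + t * orient a b d.
Proof. by rewrite /orient /xc /yc !mxE; ring. Qed.

Lemma orient_below a b z : xc a < xc b -> below_line a b z -> orient a b z < 0.
Proof.
rewrite /below_line /line_height /orient -subr_gt0 => ab.
set q := (_ / _) => H.
have -> : yc b - yc a = q * (xc b - xc a) by rewrite /q divfK // gt_eqF.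
move: ab H; nra.
Qed.

Lemma orient_above a b z : xc a < xc b -> above_line a b z -> 0 < orient a b z.
Proof.
rewrite /above_line /line_height /orient -subr_gt0 => ab.
set q := (_ / _) => H.
have -> : yc b - yc a = q * (xc b - xc a) by rewrite /q divfK // gt_eqF.
move: ab H; nra.
Qed.

Lemma on_segmentC a b z : on_segment a b z -> on_segment b a z.
Proof.
case=> t t01 ->; exists (1 - t); first by move: t01; lra.
by rewrite subKr addrC.
Qed.

Lemma segments_disjoint a b c d z : 0 < orient a b c * orient a b d ->
  on_segment a b z -> on_segment c d z -> False.
Proof.
move=> H [t t01 ->] [s s01 /(congr1 (orient a b))].
rewrite !orient_affine.
have -> : orient a b a = 0 by rewrite /orient; ring.
have -> : orient a b b = 0 by rewrite /orient; ring.
move: (orient a b c) (orient a b d) H => x y.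
rewrite !mulr0 addr0 => H E; move: H.
case: (ltrP 0 x) => x0.
  rewrite pmulr_rgt0 // => y0.
  have : 0 < (1 - s) * x + s * y by nra.
  by rewrite -E ltxx.
case: (ltrP x 0) => x1; last first.
  have -> : x = 0 by lra.
  by rewrite mul0r ltxx.
rewrite nmulr_rgt0 // => y0.
have : (1 - s) * x + s * y < 0 by nra.
by rewrite -E ltxx.
Qed.

(** At parameter [s] of the second segment [orient a b] equals [s * orient a b c], and it vanishes
    on the first one; hence [s = 0]. *)
Lemma segments_share a b c z : orient a b c != 0 ->
  on_segment a b z -> on_segment a c z -> z = a.
Proof.
move=> H [t t01 ->] [s s01 E]; move: (congr1 (orient a b) E) (E).
rewrite !orient_affine.
have -> : orient a b a = 0 by rewrite /orient; ring.
have -> : orient a b b = 0 by rewrite /orient; ring.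
rewrite !mulr0 !add0r => /esym /eqP; rewrite mulf_eq0 (negbTE H) orbF => /eqP ->.
by move=> ->; rewrite subr0 scale1r scale0r addr0.
Qed.

Lemma same_sign (s x y : R) : 0 < s * x -> 0 < s * y -> 0 < x * y.
Proof.
move=> sx sy; have : 0 < (s * s) * (x * y) by rewrite mulrACA mulr_gt0.
by have := sqr_ge0 s; rewrite expr2 => ss; apply: contraTT; rewrite -!leNgt; nra.
Qed.

Lemma sign_neq0 (s x : R) : 0 < s * x -> x != 0.
Proof. by apply: contraTneq => ->; rewrite mulr0 ltxx. Qed.

(** * Segments starting on one chain, whose turning direction is given by the sign of [s] *)

Section OneChain.
Variables (n : nat) (u : 'I_n -> point R) (s : R).
Hypothesis turn : forall i j k : 'I_n, (i < j < k)%N ->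
  0 < s * orient (u i) (u j) (u k).

(** For arcs side by side or strictly nested, [u c] and [u d] lie strictly on one side of the line
    through [u a] and [u b]. Otherwise the arcs share an end and are not collinear. *)
Lemma chain_arcs_cross (a b c d : 'I_n) z :
  (a < b)%N -> (c < d)%N -> (b <= c)%N || (a <= c)%N && (d <= b)%N ->
  (a, b) != (c, d) ->
  on_segment (u a) (u b) z -> on_segment (u c) (u d) z ->
  exists2 v, v \in [set a; b] :&: [set c; d] & z = u v.
Proof.
move=> ab cd; case: (ltngtP b c) => [bc _|cb /= /andP [ac db]|/val_inj bc _].
- move=> _ S1 S2; exfalso; apply: (segments_disjoint _ S1 S2).
  by apply: (@same_sign s); apply: turn; lia.
- case: (ltngtP a c) ac => // [ac _|/val_inj ac _].
  + case: (ltngtP d b) db => // [db _|/val_inj db _].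
    * move=> _ S1 S2; exfalso; apply: (segments_disjoint _ S1 S2).
      by apply: (@same_sign (- s)); rewrite orientC mulrNN; apply: turn; lia.
    * move=> _ /on_segmentC S1 /on_segmentC S2; exists b.
        by rewrite !inE db eqxx !orbT.
      rewrite db in S2; apply: (segments_share _ S1 S2).
      by rewrite 2!orient_cycle; apply: (@sign_neq0 s); rewrite turn //; lia.
  + rewrite -ac in cd * => nE S1 S2; exists a; first by rewrite !inE eqxx.
    apply: (segments_share _ S1 S2); rewrite orientC oppr_eq0.
    apply: (@sign_neq0 s); rewrite turn // cd ltn_neqAle db andbT.
    by apply: contraNneq nE => /val_inj ->.
- move=> _ /on_segmentC S1 S2; exists b; first by rewrite !inE bc eqxx orbT.
  rewrite -bc in cd S2; apply: (segments_share _ S1 S2).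
  rewrite orient_swap oppr_eq0.
  by apply: (@sign_neq0 s); rewrite turn // ab.
Qed.

Variable l : point R.
Hypothesis side : forall i j : 'I_n, (i < j)%N ->
  0 < - s * orient (u i) (u j) l.

(** For [k] outside of the arc, the line through [u k] and [l] leaves both ends of the arc on one
    side. For [k] strictly inside, [u k] and [l] are on the same side of the arc, as the chain
    bulges towards [l]. *)
Lemma chain_arc_rung (a b k : 'I_n) z : (a < b)%N ->
  on_segment (u a) (u b) z -> on_segment (u k) l z ->
  k \in [set a; b] /\ z = u k.
Proof.
move=> ab S1 S2; case: (ltngtP k a) => [ka|ak|/val_inj ka].
- exfalso; apply: (segments_disjoint _ S2 S1).
  rewrite 2!(orientC _ _ l) mulrNN.
  by apply: (@same_sign (- s)); apply: side; lia.
- case: (ltngtP k b) => [kb|bk|/val_inj kb].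
  + exfalso; apply: (segments_disjoint _ S1 S2).
    apply: (@same_sign (- s)); last exact: side.
    by rewrite orientC mulrNN; apply: turn; lia.
  + exfalso; apply: (segments_disjoint _ S2 S1).
    rewrite -!(orient_cycle (u k)) -!(orient_cycle l).
    by apply: (@same_sign (- s)); apply: side; lia.
  + split; first by rewrite !inE kb eqxx orbT.
    rewrite kb in S2 *; apply: (segments_share _ (on_segmentC S1) S2).
    rewrite orient_swap oppr_eq0.
    by apply: (@sign_neq0 (- s)); rewrite side.
- split; first by rewrite !inE ka eqxx.
  rewrite ka in S2 *; apply: (segments_share _ S1 S2).
  by apply: (@sign_neq0 (- s)); rewrite side.
Qed.

End OneChain.
End Orientation.

(** * Spanning trees of the double chain *)

Section Trees.
Variable T : finType.
Implicit Type E : {set {set T}}.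

Lemma adjC E : symmetric (adj E).
Proof. by move=> a b; rewrite /adj setUC. Qed.

Lemma connect_adjC E : connect_sym (adj E).
Proof. exact/sym_connect_sym/adjC. Qed.

Lemma set2_inj (a b c d : T) : [set a; b] = [set c; d] ->
  (a = c /\ b = d) \/ (a = d /\ b = c).
Proof.
move=> E; have := set21 a b; have := set22 a b; rewrite !E !inE.
have := set21 c d; have := set22 c d; rewrite -!E !inE.
case/orP=> /eqP ->; case/orP=> /eqP ->; do 2!case/orP=> /eqP ?; subst; auto.
Qed.

(** A vertex set grows one vertex at a time along an edge leaving it, and this edge is new inside
    the enlarged set. *)
Lemma connected_card E : connected_graph E -> #|T| <= #|E|.+1.
Proof.
move=> cE.
suff H k : k < #|T| ->
    exists2 S : {set T}, #|S| = k.+1 & k <= #|[set e in E | e \subset S]|.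
  case: #|T| H => [//|m] /(_ m (leqnn _)) [S _ mS].
  rewrite ltnS (leq_trans mS) // subset_leq_card //.
  by apply/subsetP=> e; rewrite inE => /andP [].
elim: k => [T0|k IH kT].
  by have /card_gt0P [a _] := T0; exists [set a]; rewrite ?cards1.
have [S Sk kS] := IH (ltnW kT).
(* If no edge left [S], it would be closed under adjacency and contain every vertex. *)
have /exists_inP [a aS /exists_inP [b bS ab]] :
    [exists a in S, exists b in ~: S, adj E a b].
  apply: contraLR kT => H; rewrite -leqNgt -Sk.
  have /card_gt0P [a aS] : 0 < #|S| by rewrite Sk.
  apply/subset_leq_card/subsetP => b _.
  rewrite -(@closed_connect _ (adj E) [in S] _ a b (cE a b)) // => c d cd.
  have out x y : adj E x y -> x \in S -> y \in S.
    move=> xy xS; apply: contraNT H => yS.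
    by apply/exists_inP; exists x => //; apply/exists_inP; exists y; rewrite ?inE.
  by apply/idP/idP; apply: out; rewrite // adjC.
rewrite inE in bS; rewrite /adj in ab; exists (b |: S); first by rewrite cardsU1 bS Sk.
rewrite (cardsD1 [set a; b]) inE ab subUset !sub1set !inE eqxx aS orbT /=.
rewrite ltnS (leq_trans kS) // subset_leq_card //; apply/subsetP => e.
rewrite !inE => /andP [-> eS] /=; rewrite (subset_trans eS (subsetUr _ _)) andbT.
apply: contraNneq bS => eE; apply: (subsetP eS); by rewrite eE set22.
Qed.

(* Deleting an edge of a cycle keeps the graph connected. *)
Lemma acyclic_of_card E : connected_graph E -> #|E| < #|T| -> acyclic_graph E.
Proof.
move=> cE EltT [|x [|y s]] // s3 /andP [] /=.
rewrite rcons_path => /and3P [xy ys lx] /and3P [].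
rewrite inE negb_or => /andP [nxy xs] nys us.
(* The rest of the cycle is a path from [y] back to [x] that avoids the deleted edge. *)
have yx' : connect (adj (E :\ [set x; y])) y x.
  apply/connectP; exists (rcons s x); last by rewrite last_rcons.
  rewrite rcons_path; apply/andP; split.
    apply: (@sub_in_path _ (predC1 x) (adj E)) ys.
      move=> c d; rewrite !inE => cx dx; rewrite /adj !inE => ->; rewrite andbT.
      apply: contraNneq cx => cd; have := set21 x y; rewrite -cd !inE eq_sym.
      by case/orP => // /eqP dE; rewrite dE eqxx in dx.
    rewrite /= eq_sym nxy; apply/allP => z zs /=.
    by apply: contraNneq xs => <-.
  rewrite /adj in lx *; rewrite !inE lx andbT.
  have ly : last y s \in s by case: (s) s3 => // z s' _ /=; exact: mem_last.
  apply: contraNneq nys => E'; have := set22 x y; rewrite -E' !inE.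
  by case/orP => /eqP yE; [rewrite yE|rewrite yE eqxx in nxy].
have : connected_graph (E :\ [set x; y]).
  move=> a b; have := cE a b; apply: connect_sub a b => a b ab.
  case: (eqVneq [set a; b] [set x; y]) => [/set2_inj [] [-> ->] //|ne].
    by rewrite connect_adjC.
  by apply: connect1; rewrite /adj !inE ne.
move/connected_card; move: EltT; rewrite (cardsD1 [set x; y]).
have -> : [set x; y] \in E by [].
by rewrite add1n => /leq_trans H /H; rewrite ltnn.
Qed.

End Trees.

(** * Non-crossing edges of the double chain *)

Section DoubleChain.
Variables (R : realType) (n : nat) (p : 'I_n + 'I_n -> point R).
Hypothesis dc : double_chain p.
Local Open Scope ring_scope.

Lemma upper_turn (i j k : 'I_n) : (i < j < k)%N ->
  0 < 1 * orient (upper p i) (upper p j) (upper p k).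
Proof.
case: dc => _ [xi H] _ _ _ ijk; rewrite mul1r orientC oppr_gt0.
apply: orient_below (H _ _ _ ijk); apply: xi; lia.
Qed.

Lemma lower_turn (i j k : 'I_n) : (i < j < k)%N ->
  0 < -1 * orient (lower p i) (lower p j) (lower p k).
Proof.
case: dc => _ _ [xi H] _ _ ijk; rewrite mulN1r -orientC.
apply: orient_above (H _ _ _ ijk); apply: xi; lia.
Qed.

Lemma upper_side (l i j : 'I_n) : (i < j)%N ->
  0 < - 1 * orient (upper p i) (upper p j) (lower p l).
Proof.
case: dc => _ [xi _] _ H _ ij; rewrite mulN1r oppr_gt0.
exact: orient_below (xi _ _ ij) (H _ _ _ ij).
Qed.

Lemma lower_side (l i j : 'I_n) : (i < j)%N ->
  0 < - -1 * orient (lower p i) (lower p j) (upper p l).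
Proof.
case: dc => _ _ [xi _] _ H ij; rewrite opprK mul1r.
exact: orient_above (xi _ _ ij) (H _ _ _ ij).
Qed.

Definition compatible (e f : {set 'I_n + 'I_n}) := forall z,
  on_edge p e z -> on_edge p f z -> exists2 v, v \in e :&: f & z = p v.

Lemma compatibleC e f : compatible e f -> compatible f e.
Proof. by move=> H z fz ez; rewrite setIC; apply: H. Qed.

Lemma on_edge2 a b z : on_edge p [set a; b] z -> on_segment (p a) (p b) z.
Proof.
by case=> c [d [/set2_inj [[-> ->] //|[-> ->]]]]; exact: on_segmentC.
Qed.

Definition upper_edge (x : 'I_n * 'I_n) : {set 'I_n + 'I_n} :=
  [set inl x.1; inl x.2].
Definition lower_edge (x : 'I_n * 'I_n) : {set 'I_n + 'I_n} :=
  [set inr x.1; inr x.2].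
Definition rung_edge (x : 'I_n * 'I_n) : {set 'I_n + 'I_n} :=
  [set inl x.1; inr x.2].

Lemma arcs_compatible (f : 'I_n -> 'I_n + 'I_n) (s : R) (x y : 'I_n * 'I_n) :
  (forall i j k : 'I_n, (i < j < k)%N ->
     0 < s * orient (p (f i)) (p (f j)) (p (f k))) ->
  (x.1 < x.2)%N -> (y.1 < y.2)%N ->
  laminar (val x.1, val x.2) (val y.1, val y.2) -> x != y ->
  compatible [set f x.1; f x.2] [set f y.1; f y.2].
Proof.
move=> turn; wlog : x y / (x.2 <= y.1)%N || (x.1 <= y.1)%N && (y.2 <= x.2)%N.
  move=> W x12 y12 l xy.
  case: (boolP ((x.2 <= y.1)%N || (x.1 <= y.1)%N && (y.2 <= x.2)%N)) => [H|H].
    exact: W.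
  apply: compatibleC; apply: W => //; last by rewrite eq_sym.
    by move: l H; rewrite /laminar /=; lia.
  by rewrite laminarC.
case: x y => [a b] [c d] /= H ab cd _ ne z /on_edge2 S1 /on_edge2 S2.
have [v] := chain_arcs_cross turn ab cd H ne S1 S2.
rewrite !inE => /andP [v1 v2] ->; exists (f v) => //.
by case/orP: v1 => /eqP <-; case/orP: v2 => /eqP <-; rewrite !inE !eqxx ?orbT.
Qed.

Lemma arc_rung_compatible (f : 'I_n -> 'I_n + 'I_n) (s : R) (x : 'I_n * 'I_n) k l :
  (forall i j k : 'I_n, (i < j < k)%N ->
     0 < s * orient (p (f i)) (p (f j)) (p (f k))) ->
  (forall i j : 'I_n, (i < j)%N -> 0 < - s * orient (p (f i)) (p (f j)) (p l)) ->
  (x.1 < x.2)%N -> compatible [set f x.1; f x.2] [set f k; l].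
Proof.
move=> turn side x12 z /on_edge2 S1 /on_edge2 S2.
have [kx ->] := chain_arc_rung turn side x12 S1 S2.
exists (f k) => //; rewrite !inE eqxx andbT.
by move: kx; rewrite !inE => /orP [] /eqP ->; rewrite eqxx ?orbT.
Qed.

Lemma upper_lower_compatible (x y : 'I_n * 'I_n) : (x.1 < x.2)%N ->
  compatible (upper_edge x) (lower_edge y).
Proof.
move=> x12 z /on_edge2 S1 /on_edge2 S2; exfalso.
apply: (segments_disjoint _ S1 S2).
by apply: (@same_sign _ (- 1)); apply: upper_side.
Qed.

(** Seen from a point of one chain, the other chain is swept in a fixed direction. So when both ends
    advance, the second rung lies on one side of the first. *)
Lemma rungs_compatible (x y : 'I_n * 'I_n) : x != y ->
  le2 (val x.1, val x.2) (val y.1, val y.2) ->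
  compatible (rung_edge x) (rung_edge y).
Proof.
case: x y => [a b] [c d] /= ne /andP [/= ac bd] z /on_edge2 S1 /on_edge2 S2.
case: (ltngtP a c) ac => // [ac|/val_inj ac] _.
- case: (ltngtP b d) bd => // [bd|/val_inj bd] _.
  + exfalso; apply: (segments_disjoint _ S1 S2); apply: (@same_sign _ 1).
    * by rewrite orientC mulrN -mulNr; apply: upper_side.
    * by rewrite -[1]opprK -orient_cycle; apply: lower_side.
  + rewrite -bd in S2 *; exists (inr b); first by rewrite !inE eqxx !orbT.
    apply: (segments_share _ (on_segmentC S1) (on_segmentC S2)).
    by rewrite -orient_cycle; apply: (@sign_neq0 _ (-1)); rewrite upper_side.
- rewrite -ac in S2 *; exists (inl a); first by rewrite !inE eqxx.
  have db : (b < d)%N.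
    by rewrite ltn_neqAle bd andbT; apply: contraNneq ne => /val_inj ->; rewrite ac.
  apply: (segments_share _ S1 S2).
  by rewrite -orient_cycle; apply: (@sign_neq0 _ (- -1)); rewrite lower_side.
Qed.

Definition edges (U L S : seq ('I_n * 'I_n)) : seq {set 'I_n + 'I_n} :=
  map upper_edge U ++ map lower_edge L ++ map rung_edge S.

Lemma edges_non_crossing U L S :
  {in U, forall x : 'I_n * 'I_n, (x.1 < x.2)%N} ->
  {in L, forall x : 'I_n * 'I_n, (x.1 < x.2)%N} ->
  {in U &, forall x y : 'I_n * 'I_n,
     laminar (val x.1, val x.2) (val y.1, val y.2)} ->
  {in L &, forall x y : 'I_n * 'I_n,
     laminar (val x.1, val x.2) (val y.1, val y.2)} ->
  {in S &, forall x y : 'I_n * 'I_n, le2 (val x.1, val x.2) (val y.1, val y.2) ||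
      le2 (val y.1, val y.2) (val x.1, val x.2)} ->
  non_crossing p [set:: edges U L S].
Proof.
move=> U1 L1 U2 L2 S2 e f; rewrite !inE !mem_cat.
suff : [|| e \in map upper_edge U, e \in map lower_edge L
         | e \in map rung_edge S] ->
   [|| f \in map upper_edge U, f \in map lower_edge L
     | f \in map rung_edge S] ->
   e != f -> compatible e f by [].
case/or3P => /mapP [x xL ->] {e}; case/or3P => /mapP [y yL ->] {f} ne.
- apply: (@arcs_compatible inl 1) => //;
    [exact: upper_turn|exact: U1|exact: U1|exact: U2|].
  by apply: contraNneq ne => ->.
- by apply: upper_lower_compatible; apply: U1.
- apply: (@arc_rung_compatible inl 1); [exact: upper_turn|exact: upper_side|exact: U1].
- by apply: compatibleC; apply: upper_lower_compatible; apply: U1.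
- apply: (@arcs_compatible inr (-1)) => //;
    [exact: lower_turn|exact: L1|exact: L1|exact: L2|].
  by apply: contraNneq ne => ->.
- rewrite /rung_edge setUC; apply: (@arc_rung_compatible inr (-1));
    [exact: lower_turn|exact: lower_side|exact: L1].
- apply: compatibleC.
  apply: (@arc_rung_compatible inl 1); [exact: upper_turn|exact: upper_side|exact: U1].
- apply: compatibleC; rewrite /rung_edge setUC.
  apply: (@arc_rung_compatible inr (-1));
    [exact: lower_turn|exact: lower_side|exact: L1].
- have xy : x != y by apply: contraNneq ne => ->.
  case/orP: (S2 x y xL yL) => H; first exact: rungs_compatible.
  by apply: compatibleC; apply: rungs_compatible; rewrite // eq_sym.
Qed.

End DoubleChain.

(** * Recurrences without fixed point *)

Section Limits.
Local Open Scope classical_set_scope.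
Local Open Scope ring_scope.
Variable R : realType.
Implicit Types (u v : nat -> R) (a b : R).

Definition tends u a := u @ \oo --> a.

Lemma tends_bounded u M : (forall k, u k <= u k.+1) -> (forall k, u k <= M) ->
  exists2 a, tends u a & forall k, u k <= a.
Proof.
move=> um uM; have nd : nondecreasing_seq u by exact/nondecreasing_seqP.
have cu : cvgn u.
  by apply: nondecreasing_is_cvgn => //; exists M => _ [k _ <-].
by exists (limn u) => // k; apply: nondecreasing_cvgn_le.
Qed.

Lemma tends_unique u a b : tends u a -> tends u b -> a = b.
Proof. exact: cvg_unique. Qed.

Lemma tends_shift u a : tends u a -> tends (fun k => u k.+1) a.
Proof. by rewrite /tends (cvg_shiftS u (nbhs a)). Qed.

Lemma tendsD u v a b : tends u a -> tends v b ->
  tends (fun k => u k + v k) (a + b).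
Proof. exact: cvgD. Qed.

Lemma tendsM u v a b : tends u a -> tends v b ->
  tends (fun k => u k * v k) (a * b).
Proof. exact: cvgM. Qed.

Lemma tends_cst a : tends (fun=> a) a.
Proof. exact: cvg_cst. Qed.

Lemma tends_eq u v a b : tends u a -> (forall k, u k.+1 = v k) -> tends v b ->
  a = b.
Proof.
move=> ua E vb; apply: (tends_unique (tends_shift ua)).
by rewrite (_ : (fun k => u k.+1) = v) //; apply/funext.
Qed.

(* Bounded monotone iterates would converge to a fixed point; with
   [a = z w c] the fixed point equations become [a (1 - a)^2 = z (1 + a (1 - a))]. *)
Lemma free_unbounded (z : R) (w c : nat -> R) :
  0 < z -> (forall a, 0 <= a < 1 -> a * (1 - a) ^+ 2 < z * (1 + a * (1 - a))) ->
  w 0%N = 0 -> c 0%N = 0 ->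
  (forall k, w k.+1 = 1 + z * w k + z * w k * c k * w k) ->
  (forall k, c k.+1 = 1 + z * w k * c k * c k) ->
  forall M, exists k, M < w k.
Proof.
move=> z0 H w0 c0 wE cE M; apply: contrapT => /forallNP nM.
have wM k : w k <= M by rewrite leNgt; apply/negP/nM.
(* Only [w] is assumed bounded; [c k <= w k] is carried along to bound [c]. *)
have mono k : [/\ 0 <= w k <= w k.+1, 0 <= c k <= c k.+1 & c k <= w k].
  elim: k => [|k [/andP [a1 a2] /andP [a3 a4] a5]].
    by rewrite wE cE w0 c0 !mulr0 !addr0 lexx ler01.
  have := wE k; have := cE k; have := wE k.+1; have := cE k.+1.
  move=> e4 e3 e2 e1; have z1 : z * w k <= z * w k.+1 by rewrite ler_pM2l.
  have z2 : 0 <= z * w k by rewrite mulr_ge0 // ltW.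
  have z3 : z * w k * c k <= z * w k.+1 * c k.+1 by apply: ler_pM.
  have z4 : 0 <= z * w k * c k by rewrite mulr_ge0.
  have z5 : z * w k * c k * w k <= z * w k.+1 * c k.+1 * w k.+1 by apply: ler_pM.
  have z6 : z * w k * c k * c k <= z * w k.+1 * c k.+1 * c k.+1 by apply: ler_pM.
  have z7 : z * w k * c k * c k <= z * w k * c k * w k by apply: ler_wpM2l.
  have z8 : 0 <= z * w k * c k * c k by rewrite mulr_ge0.
  by split; [apply/andP; split; lra|apply/andP; split; lra|lra].
have [||lw Lw lwP] := @tends_bounded w M.
- by move=> k; case: (mono k) => /andP [].
- exact: wM.
have [||lc Lc lcP] := @tends_bounded c M.
- by move=> k; case: (mono k) => _ /andP [].
- by move=> k; case: (mono k) => _ _ cw; apply: le_trans cw (wM k).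
have Ew : lw = 1 + z * lw + z * lw * lc * lw.
  apply: (tends_eq Lw wE); apply: tendsD; first apply: tendsD; do ?apply: tendsM;
  by [apply: tends_cst|].
have Ec : lc = 1 + z * lw * lc * lc.
  apply: (tends_eq Lc cE); apply: tendsD; do ?apply: tendsM;
  by [apply: tends_cst|].
have lw0 : 0 <= lw by rewrite -w0.
have lc0 : 0 <= lc by rewrite -c0.
set a := z * lw * lc in Ew Ec *.
have a0 : 0 <= a by rewrite !mulr_ge0 // ltW.
have e0 : lc * (1 - a) = 1 by lra.
have a1 : 0 <= a < 1.
  by rewrite a0; move: e0 lc0; rewrite -subr_gt0; nra.
have := H a a1.
have e1 : a * (1 - a) = z * lw.
  have -> : a * (1 - a) = z * lw * (lc * (1 - a)) by rewrite /a; ring.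
  by rewrite e0 mulr1.
have : a * (1 - a) ^+ 2 = z * (1 + a * (1 - a)).
  have : lw * (1 - a) = 1 + z * lw by lra.
  rewrite expr2 mulrA e1 => e2; rewrite -e2; ring.
by move=> ->; rewrite ltxx.
Qed.

(* Here [a = z d c], and the fixed point equations reduce to the equality case
   of the inequality assumed. *)
Lemma rooted_unbounded (z s : R) (d c e q y : nat -> R) :
  0 < z -> 0 <= s < 1 ->
  (forall a, 0 <= a < 1 / 2 ->
     a * (1 - a) ^+ 2 * (1 - 2 * a) <
     z * (1 - 2 * a) + z / (1 - s) * a * (1 - a) ^+ 2) ->
  d 0%N = 0 -> c 0%N = 0 -> e 0%N = 0 -> q 0%N = 0 -> y 0%N = 1 ->
  (forall k, d k.+1 = 1 + z * e k + z * d k * c k * d k) ->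
  (forall k, c k.+1 = 1 + z * d k * c k * c k) ->
  (forall k, e k.+1 = y k * d k + q k) ->
  (forall k, q k.+1 = z * d k * c k * e k + z * q k * c k * d k) ->
  (forall k, y k.+1 = 1 + s * y k) ->
  forall M, exists k, M < e k.
Proof.
move=> z0 /andP [s0 s1] H d0 c0 e0 q0 y0 dE cE eE qE yE M.
apply: contrapT => /forallNP nM.
have eM k : e k <= M by rewrite leNgt; apply/negP/nM.
(* The bound [(1 - s)^-1] is the fixed point of the recurrence for [y]. *)
have ymono k : 1 <= y k <= y k.+1 /\ y k <= (1 - s)^-1.
  have i1 : (1 - s)^-1 = 1 + s * (1 - s)^-1 by field; lra.
  elim: k => [|k [/andP [a1 a2] a3]].
    rewrite yE y0 i1; have : 0 <= (1 - s)^-1 by rewrite invr_ge0; lra.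
    by move=> H1; split; [apply/andP; split; nra|nra].
  by have := yE k; have := yE k.+1; move=> h1 h2; rewrite i1; split; [apply/andP; split; nra|nra].
have mono k : [/\ 0 <= d k <= d k.+1, 0 <= c k <= c k.+1, 0 <= e k <= e k.+1,
    0 <= q k <= q k.+1 & c k <= d k].
  elim: k => [|k [/andP [a1 a2] /andP [a3 a4] /andP [a5 a6] /andP [a7 a8] a9]].
    by rewrite dE cE eE qE d0 c0 e0 q0 ?mulr0 ?mul0r ?addr0 ?lexx ?ler01.
  have [/andP [y1 y2] _] := ymono k; have y3 : 0 <= y k by lra.
  have := dE k; have := cE k; have := eE k; have := qE k.
  have := dE k.+1; have := cE k.+1; have := eE k.+1; have := qE k.+1.
  move=> f4 f3 f2 f1 g4 g3 g2 g1; have z1 : z * d k <= z * d k.+1 by rewrite ler_pM2l.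
  have z2 : 0 <= z * d k by rewrite mulr_ge0 // ltW.
  have z3 : z * d k * c k <= z * d k.+1 * c k.+1 by apply: ler_pM.
  have z4 : 0 <= z * d k * c k by rewrite mulr_ge0.
  have z5 : z * d k * c k * d k <= z * d k.+1 * c k.+1 * d k.+1 by apply: ler_pM.
  have z6 : z * d k * c k * c k <= z * d k.+1 * c k.+1 * c k.+1 by apply: ler_pM.
  have z7 : z * d k * c k * c k <= z * d k * c k * d k by apply: ler_wpM2l.
  have z8 : 0 <= z * d k * c k * c k by rewrite mulr_ge0.
  have z9 : 0 <= z * e k by rewrite mulr_ge0 // ltW.
  have z10 : z * e k <= z * e k.+1 by rewrite ler_pM2l.
  have z11 : y k * d k <= y k.+1 * d k.+1 by apply: ler_pM.
  have z12 : 0 <= y k * d k by rewrite mulr_ge0.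
  have z13 : z * d k * c k * e k <= z * d k.+1 * c k.+1 * e k.+1 by apply: ler_pM.
  have z14 : 0 <= z * d k * c k * e k by rewrite mulr_ge0.
  have z15 : z * q k <= z * q k.+1 by rewrite ler_pM2l.
  have z16 : 0 <= z * q k by rewrite mulr_ge0 // ltW.
  have z17 : z * q k * c k <= z * q k.+1 * c k.+1 by apply: ler_pM.
  have z18 : 0 <= z * q k * c k by rewrite mulr_ge0.
  have z19 : z * q k * c k * d k <= z * q k.+1 * c k.+1 * d k.+1 by apply: ler_pM.
  have z20 : 0 <= z * q k * c k * d k by rewrite mulr_ge0.
  by split; try (apply/andP; split); lra.
(* As [e k.+1 = y k * d k + q k] with nonnegative terms and [1 <= y k], the bound on [e] passes to
   [q] and [d]. *)
have qM k : q k <= M.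
  have [_ _ /andP [_ h1] _ _] := mono k; have := eM k.+1; rewrite eE.
  have [/andP [h2 _] _ _ _ _] := mono k; have [/andP [h3 _] _] := ymono k.
  by nra.
have dM k : d k <= M.
  have [_ _ _ /andP [h4 _] _] := mono k; have := eM k.+1; rewrite eE.
  have [/andP [h2 _] _ _ _ _] := mono k; have [/andP [h3 _] _] := ymono k.
  by nra.
have [||ld Ld ldP] := @tends_bounded d M => //.
  by move=> k; case: (mono k) => /andP [].
have [||lc Lc lcP] := @tends_bounded c M.
- by move=> k; case: (mono k) => _ /andP [].
- by move=> k; case: (mono k) => _ _ _ _ cd; apply: le_trans cd (dM k).
have [||le Le leP] := @tends_bounded e M => //.
  by move=> k; case: (mono k) => _ _ /andP [].
have [||lq Lq lqP] := @tends_bounded q M => //.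
  by move=> k; case: (mono k) => _ _ _ /andP [].
have [||ly Ly lyP] := @tends_bounded y (1 - s)^-1.
- by move=> k; case: (ymono k) => /andP [].
- by move=> k; case: (ymono k).
have Ed : ld = 1 + z * le + z * ld * lc * ld.
  apply: (tends_eq Ld dE); apply: tendsD; first apply: tendsD; do ?apply: tendsM;
  by [apply: tends_cst|].
have Ec : lc = 1 + z * ld * lc * lc.
  apply: (tends_eq Lc cE); apply: tendsD; do ?apply: tendsM; by [apply: tends_cst|].
have Ee : le = ly * ld + lq.
  by apply: (tends_eq Le eE); apply: tendsD; do ?apply: tendsM.
have Eq : lq = z * ld * lc * le + z * lq * lc * ld.
  apply: (tends_eq Lq qE); apply: tendsD; do ?apply: tendsM; by [apply: tends_cst|].
have Ey : ly = 1 + s * ly.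
  apply: (tends_eq Ly yE); apply: tendsD; do ?apply: tendsM; by [apply: tends_cst|].
have ld1 : 1 <= ld by apply: le_trans (ldP 1%N); rewrite dE d0 e0 !mulr0 !addr0.
have lc1 : 1 <= lc by apply: le_trans (lcP 1%N); rewrite cE c0 !mulr0 !addr0.
have le0 : 0 <= le by rewrite -e0.
have ly1 : 1 <= ly by rewrite -y0.
have {}Ey : ly = (1 - s)^-1.
  have : ly * (1 - s) = 1 by lra.
  have s1' : 1 - s != 0 by rewrite gt_eqF //; lra.
  by move=> h; apply: (mulIf s1'); rewrite mulVf.
set a := z * ld * lc in Ed Ec Eq.
have a0 : 0 <= a by rewrite !mulr_ge0 //; lra.
have e1 : lc * (1 - a) = 1 by lra.
have a1 : 0 < 1 - a by rewrite -(pmulr_rgt0 _ (lt_le_trans ltr01 lc1)) e1.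
have e2 : a * (1 - a) = z * ld.
  have -> : a * (1 - a) = z * ld * (lc * (1 - a)) by rewrite /a; ring.
  by rewrite e1 mulr1.
have e3 : lq * (1 - a) = a * le.
  have h : z * lq * lc * ld = a * lq by rewrite /a; ring.
  by move: Eq; rewrite h; lra.
have e4 : le * (1 - 2 * a) = ly * ld * (1 - a).
  have : le * (1 - a) = ly * ld * (1 - a) + lq * (1 - a) by rewrite {1}Ee; ring.
  by rewrite e3; lra.
(* The right side of [e4] is positive, which forces [a] into the range where [H] applies. *)
have a2 : 0 < 1 - 2 * a.
  have : 0 < le * (1 - 2 * a) by rewrite e4 !mulr_gt0 //; lra.
  move=> h; rewrite -(pmulr_rgt0 _ (_ : 0 < le)) // lt_neqAle le0 andbT.
  by apply: contraTneq h => <-; rewrite mul0r ltxx.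
have [|] := boolP (a < 1 / 2); last by move=> h; exfalso; move: h a2; lra.
move=> ah; have := H a; rewrite a0 ah => /(_ isT); apply/negP; rewrite -leNgt.
rewrite -Ey.
have e5 : ld * (1 - a) = 1 + z * le by lra.
have -> : a * (1 - a) ^+ 2 = z * (1 + z * le) by rewrite expr2 mulrA e2 -e5; ring.
have -> : z * ly * a * (1 - a) ^+ 2 = z * (z * (le * (1 - 2 * a))).
  rewrite e4 expr2 -[z * ly * a * _]mulrA [a * _]mulrA e2; ring.
by rewrite le_eqVlt; apply/orP; left; apply/eqP; ring.
Qed.

End Limits.

(** * Enumeration of words *)

Definition arc_words (A B C : seq word) : seq word :=
  [seq Arc uc.1 uc.2 t | uc <- [seq (u, c) | u <- A, c <- B], t <- C].

Lemma arc_wordsP A B C w :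
  reflect (exists u c t, [/\ u \in A, c \in B, t \in C & w = Arc u c t])
    (w \in arc_words A B C).
Proof.
apply: (iffP allpairsP) => [[[uc t] /= [/allpairsP [[u c] /= [uA cB ->]] tC ->]]|].
  by exists u, c, t.
move=> [u [c [t [uA cB tC ->]]]]; exists ((u, c), t) => /=; split=> //.
by apply/allpairsP; exists (u, c).
Qed.

Lemma arc_words_uniq A B C : uniq A -> uniq B -> uniq C ->
  uniq (arc_words A B C).
Proof.
move=> uA uB uC; apply: allpairs_uniq => //.
  by apply: allpairs_uniq => // -[? ?] [? ?] _ _ [-> ->].
by move=> [[? ?] ?] [[? ?] ?] _ _ /= [-> -> ->].
Qed.

(* The rootless words of nesting depth less than [k], and the barless ones
   among them. *)
Fixpoint free_words k : seq word * seq word :=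
  if k is k'.+1 then
    let: (W, C) := free_words k' in
    (Eps :: map Bar W ++ arc_words W C W, Eps :: arc_words W C C)
  else ([::], [::]).

Lemma free_wordsP k :
  [/\ {subset (free_words k).1 <= rootless},
      {subset (free_words k).2 <= predI rootless barless},
      uniq (free_words k).1 & uniq (free_words k).2].
Proof.
elim: k => [|k] //=; case: (free_words k) => W C /= [rW rC uW uC]; split.
- move=> w; rewrite inE mem_cat => /or3P [/eqP -> //|/mapP [t /rW tW ->] //|].
  case/arc_wordsP => u [c [t [/rW uW' /rC /andP [/= cC bc] /rW tW ->]]].
  by rewrite unfold_in /=; apply/and4P.
- move=> w; rewrite inE => /predU1P [-> //|].
  case/arc_wordsP => u [c [t [/rW uW' /rC /andP [/= cC bc] /rC /andP [/= tC bt] ->]]].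
  by rewrite unfold_in /=; apply/andP; split=> //; apply/and4P.
- rewrite cat_uniq mem_cat negb_or map_inj_uniq ?uW; last by move=> ? ? [].
  rewrite arc_words_uniq // andbT /=; apply/andP; split.
    by apply/andP; split; [apply/negP => /mapP []|apply/negP => /arc_wordsP [? [? [? []]]]].
  by apply/hasPn => w /arc_wordsP [u [c [t [_ _ _ ->]]]]; apply/negP => /mapP [].
- by rewrite arc_words_uniq // andbT; apply/negP => /arc_wordsP [? [? [? []]]].
Qed.

(** Each list must be finite, so the number of steps at a root is cut off at [n]; [rooted_words]
    lets [n] grow with the depth, which yields partial geometric sums. *)
Definition root_words n (A : seq word) : seq word :=
  [seq Root e t | e <- index_iota 0 n, t <- A].
Arguments root_words : simpl never.

(** [chains] are the barless words among the unrooted ones, the form required of [c] in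
    [Arc u c t]. *)
Record word_lists := WordLists {
  unrooted : seq word; chains : seq word; inner : seq word; all_rooted : seq word }.

(* [inner] lists the rooted words that do not start with a root. *)
Fixpoint rooted_words k : word_lists :=
  if k is k'.+1 then
    let: WordLists D C P E := rooted_words k' in
    WordLists (Eps :: map Bar E ++ arc_words D C D)
      (Eps :: arc_words D C C)
      (arc_words D C E ++ arc_words P C D)
      (root_words k'.+1 D ++ P)
  else WordLists [::] [::] [::] [::].

Lemma rooted_wordsP k : let: WordLists D C P E := rooted_words k in
  [/\ [/\ {subset D <= [pred w | one_root w & ~~ rooted w]},
      {subset C <= [pred w | [&& one_root w, ~~ rooted w & barless w]]},
      {subset P <= [pred w | [&& one_root w, rooted w & ~~ starts_with_root w]]} &
      {subset E <= [pred w | one_root w & rooted w]}],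
      uniq D, uniq C, uniq P & uniq E].
Proof.
elim: k => [|k] //=.
case: (rooted_words k) => D C P E [[rD rC rP rE] uD uC uP uE].
have arcE A B C' (w : word) (Q : pred word) : 
   (forall u c t, u \in A -> c \in B -> t \in C' -> Q (Arc u c t)) ->
   w \in arc_words A B C' -> Q w.
  by move=> H /arc_wordsP [u [c [t [uA cB tC ->]]]]; apply: H.
have noEps A B C' : Eps \notin arc_words A B C'.
  by apply/negP => /arc_wordsP [? [? [? []]]].
split.
- split=> w.
  + rewrite inE mem_cat => /or3P [/eqP -> //|/mapP [t /rE /= tE ->]|].
      by rewrite inE /= andbT.
    apply: arcE => u c t /rD /andP [/= u1 u2] /rC /and3P [c1 c2 c3] /rD /andP [/= t1 t2].
    by rewrite /= u1 (unrooted_start u2) c1 c2 c3 t1 (negbTE u2) (negbTE t2).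
  + rewrite inE => /predU1P [-> //|].
    apply: arcE => u c t /rD /andP [/= u1 u2] /rC /and3P [c1 c2 c3] /rC /and3P [t1 t2 t3].
    by rewrite /= u1 (unrooted_start u2) c1 c2 c3 t1 (negbTE u2) (negbTE t2) t3.
  + rewrite mem_cat => /orP [].
      apply: arcE => u c t /rD /andP [/= u1 u2] /rC /and3P [c1 c2 c3] /rE /andP [/= t1 t2].
      by rewrite /= u1 (unrooted_start u2) c1 c2 c3 t1 (negbTE u2) t2.
    apply: arcE => u c t /rP /and3P [u1 u2 u3] /rC /and3P [c1 c2 c3] /rD /andP [/= t1 t2].
    by rewrite /= u1 u2 u3 c1 c2 c3 t1 (negbTE t2).
  + rewrite mem_cat => /orP [/allpairsP [[e t] /= [_ /rD /andP [/= t1 t2] ->]]|/rP /and3P [w1 w2 _]].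
      by rewrite inE /= t1 t2.
    by rewrite inE w1 w2.
- rewrite /= cat_uniq mem_cat negb_or noEps map_inj_uniq ?uE; last by move=> ? ? [].
  rewrite arc_words_uniq // andbT !andbT; apply/andP; split.
    by apply/negP => /mapP [].
  by apply/hasPn => w /arc_wordsP [u [c [t [_ _ _ ->]]]]; apply/negP => /mapP [].
- by rewrite /= noEps arc_words_uniq.
(* The two families are disjoint: [u] is unrooted in the first and rooted in the second. *)
- rewrite cat_uniq !arc_words_uniq // andbT /=; apply/hasPn => w.
  move=> /arc_wordsP [u [c [t [/rP /and3P [_ u2 _] _ _ ->]]]].
  apply/negP => /arc_wordsP [u' [c' [t' [/rD /andP [/= _ u2'] _ _ [E' _ _]]]]].
  by rewrite -E' u2 in u2'.
- rewrite cat_uniq uP andbT; apply/andP; split.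
    by apply: allpairs_uniq; rewrite ?iota_uniq // => -[? ?] [? ?] _ _ /= [-> ->].
  apply/hasPn => w /rP /and3P [_ _ w3]; apply: contra w3.
  by move=> /allpairsP [[e t] /= [_ _ ->]].
Qed.

(** * From unbounded weights to many words of one size *)

Section Weights.
Variable R : realType.
Local Open Scope ring_scope.
Variables z s : R.

Definition weight (l : seq word) : R :=
  \sum_(w <- l) z ^+ width w * s ^+ steps w.

Lemma weight_cat l l' : weight (l ++ l') = weight l + weight l'.
Proof. exact: big_cat. Qed.

Lemma weight_cons w l : weight (w :: l) = z ^+ width w * s ^+ steps w + weight l.
Proof. exact: big_cons. Qed.

Lemma weight_nil : weight [::] = 0.
Proof. exact: big_nil. Qed.

Lemma weight_bar l : weight (map Bar l) = z * weight l.
Proof.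
rewrite /weight big_map mulr_sumr; apply: eq_bigr => w _ /=.
by rewrite exprS mulrA.
Qed.

Lemma weight_arc A B C :
  weight (arc_words A B C) = z * weight A * weight B * weight C.
Proof.
rewrite -!mulrA mulrA {1 2}/weight /arc_words big_allpairs_dep big_allpairs_dep /=.
rewrite mulr_sumr mulr_suml; apply: eq_bigr => u _.
rewrite /weight mulr_suml mulr_sumr; apply: eq_bigr => c _.
rewrite !mulr_sumr; apply: eq_bigr => t _.
by rewrite exprS !exprD; ring.
Qed.

Lemma weight_root k l :
  weight (root_words k l) =
  (\sum_(0 <= e < k) s ^+ e) * weight l.
Proof.
rewrite /weight /root_words big_allpairs_dep mulr_suml.
apply: eq_bigr => e _; rewrite mulr_sumr; apply: eq_bigr => t _ /=.
by rewrite exprD; ring.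
Qed.

(** Sorting the words by width and steps bounds the weight by a product of geometric series of
    ratios [z * A] and [s * B]. *)
Lemma weight_bounded A B K l : 0 <= z -> 0 <= s -> z * A < 1 -> s * B < 1 ->
  0 <= A -> 0 <= B -> 0 <= K ->
  (forall m i, (count (fun w => (width w == m) && (steps w == i)) l)%:R
      <= K * A ^+ m * B ^+ i) ->
  weight l <= K / ((1 - z * A) * (1 - s * B)).
Proof.
move=> z0 s0 zA sB A0 B0 K0 H.
pose N := (\max_(w <- l) maxn (width w) (steps w)).+1.
have big w : w \in l -> (width w < N)%N /\ (steps w < N)%N.
  move=> wl; suff : (maxn (width w) (steps w) < N)%N by rewrite gtn_max => /andP.
  rewrite ltnS.
  exact: (@leq_bigmax_seq _ l xpredT (fun w => maxn (width w) (steps w)) w wl).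
pose f w : 'I_N * 'I_N := (inord (width w), inord (steps w)).
rewrite /weight (partition_big f predT) //=.
have geo (x : R) : 0 <= x < 1 -> \sum_(i < N) x ^+ i <= (1 - x)^-1.
  move=> /andP [x0 x1]; have x2 : 0 < 1 - x by rewrite subr_gt0.
  rewrite -[leRHS]mul1r ler_pdivlMr // mulrC -opprB mulNr -subrX1 opprB.
  by rewrite lerBlDr lerDl exprn_ge0.
apply: (@le_trans _ _ (\sum_(j : 'I_N * 'I_N) K * (z * A) ^+ j.1 * (s * B) ^+ j.2)).
  apply: ler_sum => -[m i] _ /=.
  rewrite big_seq_cond.
  rewrite (eq_bigr (fun=> z ^+ m * s ^+ i)); last first.
    move=> w /andP [wl /eqP [<- <-]]; have [h1 h2] := big w wl.
    by rewrite !inordK.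
  rewrite -big_seq_cond big_const_seq iter_addr_0 -mulr_natr.
  apply: (@le_trans _ _ (z ^+ m * s ^+ i * (K * A ^+ m * B ^+ i))); last first.
    by rewrite !exprMn le_eqVlt; apply/orP; left; apply/eqP; ring.
  apply: ler_wpM2l; first by rewrite mulr_ge0 ?exprn_ge0.
  apply: le_trans (H m i); rewrite ler_nat; rewrite -!size_filter.
  rewrite (_ : [seq x <- l | f x == (m, i)] =
      [seq w <- l | (width w == m) && (steps w == i)]) //.
  apply: eq_in_filter => w wl; have [h1 h2] := big w wl.
  by rewrite /f xpair_eqE -!val_eqE /= !inordK.
rewrite -(pair_bigA _ (fun m i : 'I_N => K * (z * A) ^+ m * (s * B) ^+ i)) /=.
have zA0 : 0 <= z * A by rewrite mulr_ge0.
have sB0 : 0 <= s * B by rewrite mulr_ge0.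
rewrite (eq_bigr (fun m : 'I_N =>
  K * (z * A) ^+ m * \sum_(i < N) (s * B) ^+ i)); last first.
  by move=> m _; rewrite mulr_sumr.
rewrite -mulr_suml -mulr_sumr invfM mulrA.
apply: ler_pM; rewrite ?mulr_ge0 ?sumr_ge0 // ?geo ?sB0 //; first
  by move=> i _; apply: exprn_ge0.
  by move=> i _; apply: exprn_ge0.
by apply: ler_wpM2l => //; rewrite geo ?zA0.
Qed.

Lemma abundant A B K (L : nat -> seq word) :
  0 <= z -> 0 <= s -> z * A < 1 -> s * B < 1 -> 0 <= A -> 0 <= B -> 0 <= K ->
  (forall M, exists k, M < weight (L k)) ->
  exists k m i,
    K * A ^+ m * B ^+ i <
    (size [seq w <- L k | (width w == m) && (steps w == i)])%:R.
Proof.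
move=> z0 s0 zA sB A0 B0 K0 /(_ (K / ((1 - z * A) * (1 - s * B)))) [k Mk].
apply: contrapT => no; move: Mk; apply/negP; rewrite -leNgt.
apply: weight_bounded => // m i; rewrite leNgt; apply/negP => h; apply: no.
by exists k, m, i; rewrite size_filter.
Qed.

End Weights.

(** * Concatenation of words *)

Fixpoint append w v : word :=
  match w with
  | Eps => v
  | Bar t => Bar (append t v)
  | Root e t => Root e (append t v)
  | Arc u c t => Arc u c (append t v)
  end.

Lemma width_append w v : width (append w v) = width w + width v.
Proof. by elim: w => [|t IH|e t IH|u _ c _ t IH] //=; rewrite IH; lia. Qed.

Lemma steps_append w v : steps (append w v) = steps w + steps v.
Proof. by elim: w => [|t IH|e t IH|u _ c _ t IH] //=; rewrite IH; lia. Qed.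

(** Equal widths put the separating [Bar] at the same place; otherwise a bar of [w] or [v] could be
    mistaken for it. *)
Lemma append_bar_inj w w' v v' : width w = width w' ->
  append w (Bar v) = append w' (Bar v') -> w = w' /\ v = v'.
Proof.
elim: w w' => [|t IH|e t IH|u _ c _ t IH] [|t'|e' t'|u' c' t'] //=.
- by move=> _ [].
- by move=> [wE] [/(IH _ wE) [-> ->]].
- by move=> wE [-> /(IH _ wE) [-> ->]].
- by move=> [wE] [uE cE]; subst u' c' => /(IH t') []; [lia|move=> -> ->].
Qed.

Lemma rootless_append w v : rootless w -> rootless v -> rootless (append w (Bar v)).
Proof.
by elim: w => [|t IH|e t IH|u _ c _ t IH] //= /and4P [-> -> -> /IH].
Qed.

Lemma one_root_append w v : one_root w -> one_root v -> rooted v ->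
  one_root (append w (Bar v)) /\ rooted (append w (Bar v)) = rooted w.
Proof.
move=> + wv rv; elim: w => [|t IH|e t IH|u _ c _ t IH] /=; first by rewrite wv rv.
- by case/andP => /IH [-> ->] ->.
- by case/andP => /IH [-> ->] ->.
- by case/and5P => -> -> -> -> /and3P [-> /IH [-> ->] ->].
Qed.

(** The last block is taken from [b], so that it can carry the padding to an exact width. *)
Fixpoint power (l b : seq word) k : seq word :=
  if k is k'.+1 then [seq append w (Bar v) | w <- l, v <- power l b k'] else b.

Lemma powerP (Q : pred word) (l b : seq word) m i m' i' k :
  (forall w v, Q w -> Q v -> Q (append w (Bar v))) ->
  uniq l -> uniq b ->
  {in l, forall w, [&& Q w, width w == m & steps w == i]} ->
  {in b, forall w, [&& Q w, width w == m' & steps w == i']} ->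
  [/\ uniq (power l b k), size (power l b k) = (size l ^ k * size b)%N &
    {in power l b k, forall w,
      [&& Q w, width w == (k * m.+1 + m')%N & steps w == (k * i + i')%N]}].
Proof.
move=> QA ul ub lP bP; elim: k => [|k [uk sk kP]] /=.
  by rewrite mul1n; split.
split.
- have fl x : x \in [seq (w, v) | w <- l, v <- power l b k] -> x.1 \in l.
    by case/allpairsP => y [yl _ ->].
  apply: (@allpairs_uniq _ _ _ (fun w v => append w (Bar v))) => //.
  move=> -[w v] [w' v'] /fl /= wl /fl /= wl'.
  move=> /append_bar_inj [|-> ->] //.
  by move: (lP _ wl) (lP _ wl') => /and3P [_ /eqP -> _] /and3P [_ /eqP -> _].
- by rewrite size_allpairs sk expnS mulnA.
- move=> x /allpairsP [[w v] /= [/lP /and3P [Qw /eqP ww /eqP sw]]].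
  move=> /kP /and3P [Qv /eqP wv /eqP sv] ->.
  rewrite QA //= width_append steps_append /= ww sw wv sv.
  by apply/andP; split; apply/eqP; lia.
Qed.

(** * Growth rates of the two classes of words *)

Section Growth.
Variable R : realType.
Local Open Scope ring_scope.

Lemma free_words_unbounded (s M : R) :
  exists k, M < weight (5 / 41) s (free_words k).1.
Proof.
apply: (@free_unbounded R (5 / 41) _ (fun k => weight (5 / 41) s (free_words k).2)).
- by lra.
- (* the minimum of [z (1 + a (1 - a)) - a (1 - a)^2] is near [311 / 1000] *)
  move=> a /andP [a0 a1]; rewrite expr2.
  have h := mulr_ge0 (sqr_ge0 (a - 311 / 1000)) (_ : 0 <= 1 - a).
  have {}h : 0 <= (a - 311 / 1000) ^+ 2 * (1 - a) by apply: h; lra.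
  have h2 := sqr_ge0 (a - 311 / 1000); rewrite !expr2 in h h2.
  nra.
- by rewrite weight_nil.
- by rewrite weight_nil.
- move=> k /=; case: (free_words k) => W C /=.
  by rewrite weight_cons weight_cat weight_bar weight_arc /= !expr0 mul1r addrA.
- move=> k /=; case: (free_words k) => W C /=.
  by rewrite weight_cons weight_arc /= !expr0 mul1r.
Qed.

Lemma rooted_words_unbounded (M : R) :
  exists k, M < weight (100 / 1253) (13 / 20) (all_rooted (rooted_words k)).
Proof.
apply: (@rooted_unbounded R (100 / 1253) (13 / 20)
  (fun k => weight (100 / 1253) (13 / 20) (unrooted (rooted_words k)))
  (fun k => weight (100 / 1253) (13 / 20) (chains (rooted_words k)))
  _
  (fun k => weight (100 / 1253) (13 / 20) (inner (rooted_words k)))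
  (fun k => \sum_(0 <= e < k.+1) (13 / 20) ^+ e)).
- by lra.
- by lra.
- (* the difference of both sides is smallest near [21 / 100] *)
  move=> a /andP [a0 a1]; rewrite expr2.
  have h1 : 0 <= (a - 21 / 100) ^+ 2 * (1 / 2 - a).
    by apply: mulr_ge0; [exact: sqr_ge0|lra].
  have h2 : 0 <= (a - 21 / 100) ^+ 2 * (1 / 2 - a) ^+ 2.
    by rewrite mulr_ge0 ?sqr_ge0.
  have h3 := sqr_ge0 (a - 21 / 100).
  rewrite !expr2 in h1 h2 h3.
  have -> : 100 / 1253 / (1 - 13 / 20) = 100 / 1253 * (20 / 7) :> R by field.
  nra.
- by rewrite weight_nil.
- by rewrite weight_nil.
- by rewrite weight_nil.
- by rewrite weight_nil.
- by rewrite big_nat1 expr0.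
- move=> k /=; case: (rooted_words k) => D C P E /=.
  by rewrite weight_cons weight_cat weight_bar weight_arc /= !expr0 mul1r addrA.
- move=> k /=; case: (rooted_words k) => D C P E /=.
  by rewrite weight_cons weight_arc /= !expr0 mul1r.
- move=> k /=; case: (rooted_words k) => D C P E /=.
  by rewrite weight_cat weight_root.
- move=> k /=; case: (rooted_words k) => D C P E /=.
  by rewrite weight_cat !weight_arc.
- move=> k; rewrite big_nat_recl // expr0; congr (_ + _).
  by rewrite mulr_sumr; apply: eq_bigr => e _; rewrite exprS.
Qed.

Lemma many_rootless : exists2 c : R, 0 < c & forall N, exists l : seq word,
  [/\ uniq l, {in l, forall w, rootless w && (width w == N)} &
    c * (163 / 20) ^+ N <= (size l)%:R].
Proof.
(* Here [z * A = 163 / 164]. Rootless words have no steps, whence the rate 1 for them; [1 / 2] is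
   just some weight below 1. *)
have [||||||||k [m [i]]] := @abundant R (5 / 41) (1 / 2) (163 / 20) 1 (163 / 20)
   (fun k => (free_words k).1); try lra.
  exact: free_words_unbounded.
(* The factor [K] raises the exponent to [m.+1]: a block of width [m] uses one more slot for the
   [Bar] after it. *)
rewrite expr1n mulr1 -exprS; set l := [seq w <- _ | _] => lbig.
have [sub _ ul _] := free_wordsP k.
have lP : {in l, forall w, [&& rootless w, width w == m & steps w == 0%N]}.
  move=> w; rewrite mem_filter => /andP [/andP [wm _] /sub rw].
  by rewrite [rootless w]rw wm rootless_steps.
(* The constant pays for the incomplete block of [r] bars at the end. *)
exists ((163 / 20) ^- m.+1); first by rewrite invr_gt0 exprn_gt0 //; lra.
move=> N; set q := (N %/ m.+1)%N; set r := (N %% m.+1)%N.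
have [|u1 s1 p1] := @powerP rootless l [:: iter r Bar Eps] m 0 r 0 q
  rootless_append (seq.filter_uniq _ ul) isT lP.
  move=> w; rewrite inE => /eqP ->; elim: (r) => //= r' /and3P [-> /eqP -> /eqP ->].
rewrite /= muln1 in s1; exists (power l [:: iter r Bar Eps] q); split=> //.
  by move=> w /p1 /and3P [-> /eqP -> _] /=; rewrite -divn_eq.
have g1 : 1 <= 163 / 20 :> R by lra.
have g0 : 0 < 163 / 20 :> R by lra.
rewrite s1 natrX mulrC ler_pdivrMr ?exprn_gt0 //.
apply: (@le_trans _ _ ((163 / 20) ^+ (q * m.+1)%N * (163 / 20) ^+ m.+1)).
  rewrite -exprD ler_weXn2l // {1}(divn_eq N m.+1) leq_add2l ltnW //.
  exact: ltn_pmod.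
rewrite ler_wpM2r ?exprn_ge0 //; first exact: ltW.
by rewrite mulnC exprM lerXn2r ?nnegrE ?exprn_ge0 ?ler0n // ltW.
Qed.

(* [1252 / 815] is the ratio of [12.52 = 313 / 25] to the growth rate
   [163 / 20] of the rootless words, which the steps are paired with. *)
Lemma many_rooted : exists m i (l : seq word),
  [/\ uniq l,
      {in l, forall w, [&& one_root w && rooted w, width w == m & steps w == i]} &
      (313 / 25) ^+ m.+1 * (1252 / 815) ^+ i <= (size l)%:R :> R].
Proof.
(* Here [z * A = 1252 / 1253] and [s * B = 4069 / 4075], both just below 1. *)
have [||||||||k [m [i]]] := @abundant R (100 / 1253) (13 / 20) (313 / 25)
   (1252 / 815) (313 / 25) (fun k => all_rooted (rooted_words k)); try lra.
  exact: rooted_words_unbounded.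
rewrite -exprS; set l := [seq w <- _ | _] => lbig.
have := rooted_wordsP k; rewrite {}/l in lbig *.
case: (rooted_words k) lbig => D C P E /= lbig [[_ _ _ sub] _ _ _ uE].
exists m, i, [seq w <- E | (width w == m) && (steps w == i)]; split.
- exact: seq.filter_uniq.
- by move=> w; rewrite mem_filter => /andP [-> /sub]; rewrite inE => ->.
- exact: ltW.
Qed.

End Growth.

(** * Trees built from two halves *)

Lemma arcs_append j w v :
  arcs j (append w v) = arcs j w ++ arcs (j + width w) v.
Proof.
elim: w j => [|t IH|e t IH|u _ c _ t IH] j /=.
- by rewrite addn0.
- by rewrite IH addSnnS.
- exact: IH.
- by rewrite IH -!catA; congr (_ :: _ ++ _ ++ _ ++ arcs _ _); lia.
Qed.

(** The tags [inl] and [inr] tell the three kinds of edges apart, and [x.1 < x.2] recovers the order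
    of the ends of an arc. *)
Lemma mem_edges n (U L S U' L' S' : seq ('I_n * 'I_n)) :
  {in U, forall x : 'I_n * 'I_n, x.1 < x.2} ->
  {in L, forall x : 'I_n * 'I_n, x.1 < x.2} ->
  {in U', forall x : 'I_n * 'I_n, x.1 < x.2} ->
  {in L', forall x : 'I_n * 'I_n, x.1 < x.2} ->
  edges U L S =i edges U' L' S' -> [/\ U =i U', L =i L' & S =i S'].
Proof.
have ordered (x y : 'I_n * 'I_n) : x.1 < x.2 -> y.1 < y.2 ->
    (x.1 = y.1 /\ x.2 = y.2) \/ (x.1 = y.2 /\ x.2 = y.1) -> x = y.
  case: x y => [a b] [c d] /= ab cd [[-> ->] //|[ad bc]].
  by rewrite ad bc in ab; move: (ltn_trans ab cd); rewrite ltnn.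
have sub U1 L1 S1 U2 L2 S2 :
    {in U1, forall x : 'I_n * 'I_n, x.1 < x.2} ->
    {in L1, forall x : 'I_n * 'I_n, x.1 < x.2} ->
    {in U2, forall x : 'I_n * 'I_n, x.1 < x.2} ->
    {in L2, forall x : 'I_n * 'I_n, x.1 < x.2} ->
    edges U1 L1 S1 =i edges U2 L2 S2 ->
    [/\ {subset U1 <= U2}, {subset L1 <= L2} & {subset S1 <= S2}].
  move=> U1o L1o U2o L2o E; split=> x xin.
  - have : upper_edge x \in edges U2 L2 S2 by rewrite -E mem_cat map_f.
    rewrite !mem_cat => /or3P [] /mapP [y yin /set2_inj H].
    + suff -> : x = y by []. apply: ordered; [exact: U1o|exact: U2o|].
      by case: H => [[[-> ] [->]]|[[->] [->]]]; [left|right].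
    + by case: H => [[]|[]].
    + by case: H => [[]|[]].
  - have : lower_edge x \in edges U2 L2 S2 by rewrite -E !mem_cat map_f ?orbT.
    rewrite !mem_cat => /or3P [] /mapP [y yin /set2_inj H].
    + by case: H => [[]|[]].
    + suff -> : x = y by []. apply: ordered; [exact: L1o|exact: L2o|].
      by case: H => [[[-> ] [->]]|[[->] [->]]]; [left|right].
    + by case: H => [[]|[]].
  - have : rung_edge x \in edges U2 L2 S2 by rewrite -E !mem_cat map_f ?orbT.
    rewrite !mem_cat => /or3P [] /mapP [y yin /set2_inj H].
    + by case: H => [[]|[]].
    + by case: H => [[]|[]].
    + suff -> : x = y by []. move: H; case: (x) (y) => [a b] [c d] /=.
      by case=> [[[->] [->]]|[]].
move=> Uo Lo Uo' Lo' E.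
have [u1 l1 s1] := sub _ _ _ _ _ _ Uo Lo Uo' Lo' E.
have [u2 l2 s2] := sub _ _ _ _ _ _ Uo' Lo' Uo Lo (fsym E).
by split=> x; apply/idP/idP; auto.
Qed.

Definition swap (x : nat * nat) := (x.2, x.1).

Section Assembly.
Variables N M : nat.
Let n := (N + M).+2.

(** [inord] sends numbers out of range to 0, so injectivity is only claimed on [bounded] lists. *)
Definition ord2 (x : nat * nat) : 'I_(N + M).+2 * 'I_(N + M).+2 :=
  (inord x.1, inord x.2).
Definition val2 (x : 'I_(N + M).+2 * 'I_(N + M).+2) : nat * nat :=
  (val x.1, val x.2).

Definition bounded (s : seq (nat * nat)) :=
  {in s, forall x : nat * nat, x.1 < n /\ x.2 < n}.

Lemma ord2K x : x.1 < n -> x.2 < n -> val2 (ord2 x) = x.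
Proof. by case: x => a b ha hb; rewrite /val2 /ord2 /= !inordK. Qed.

Lemma map_ord2K s : bounded s -> map val2 (map ord2 s) = s.
Proof.
move=> sn; rewrite -map_comp -[RHS]map_id; apply/eq_in_map => x /sn [].
exact: ord2K.
Qed.

Lemma map_ord2_inj s t : bounded s -> bounded t ->
  map ord2 s =i map ord2 t -> s =i t.
Proof.
by move=> sn tn E x; rewrite -(map_ord2K sn) -(map_ord2K tn); apply: eq_mem_map.
Qed.

(* The two halves sit side by side; in the second one the chains exchange their
   roles.  In each half the first word is rootless and the second one rooted. *)
Definition halves := ((word * word) * (word * word))%type.

(** [Arc Eps Eps] draws the edge from [N] to [N.+1], the only link between the halves: on the lower
    chain a [Bar] separates them. *)
Definition upper_arcs (t : halves) := arcs 0 (append t.1.1 (Arc Eps Eps t.2.2)).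
Definition lower_arcs (t : halves) := arcs 0 (append t.1.2 (Bar t.2.1)).
Definition all_rungs (t : halves) :=
  rungs [in heads 0 t.1.1] 0 0 t.1.2
  ++ map swap (rungs [in heads M.+1 t.2.1] M.+1 N.+1 t.2.2).

(** Both halves have [N.+1] points on their first chain and [M.+1] on their second, so after the
    exchange each chain has [(N + M).+2] points. *)
Definition half_ok (h : word * word) :=
  [/\ rootless h.1, one_root h.2, rooted h.2, width h.1 = N &
      width h.2 = M /\ steps h.2 = N].

Definition tree_of (t : halves) : {set {set 'I_(N + M).+2 + 'I_(N + M).+2}} :=
  [set:: edges (map ord2 (upper_arcs t)) (map ord2 (lower_arcs t))
     (map ord2 (all_rungs t))].

Section OneTree.
Variable t : halves.
Hypothesis ok1 : half_ok t.1.
Hypothesis ok2 : half_ok t.2.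

Lemma upper_arcsE :
  upper_arcs t = arcs 0 t.1.1 ++ (N, N.+1) :: arcs N.+1 t.2.2.
Proof.
by case: ok1 => _ _ _ wE _; rewrite /upper_arcs arcs_append wE /= !addn0.
Qed.

Lemma lower_arcsE : lower_arcs t = arcs 0 t.1.2 ++ arcs M.+1 t.2.1.
Proof. by case: ok1 => _ _ _ _ [wE _]; rewrite /lower_arcs arcs_append wE. Qed.

Lemma upper_arcs_range :
  {in upper_arcs t, forall x : nat * nat, x.1 < x.2 /\ x.2 < n}.
Proof.
case: ok1 ok2 => _ _ _ wE [wE' _] [_ _ _ wE'' [wE''' _]] x /arcs_range.
rewrite width_append /= wE wE''' /n => -[*]; lia.
Qed.

Lemma lower_arcs_range :
  {in lower_arcs t, forall x : nat * nat, x.1 < x.2 /\ x.2 < n}.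
Proof.
case: ok1 ok2 => _ _ _ wE [wE' _] [_ _ _ wE'' [wE''' _]] x /arcs_range.
rewrite width_append /= wE' wE'' /n => -[*]; lia.
Qed.

Lemma left_rungs_range (x : nat * nat) : x \in rungs [in heads 0 t.1.1] 0 0 t.1.2 ->
  x.1 <= N /\ x.2 <= M.
Proof.
by case: ok1 => _ _ _ _ [wE sE] /rungs_range; rewrite wE sE => -[].
Qed.

Lemma right_rungs_range (x : nat * nat) :
  x \in map swap (rungs [in heads M.+1 t.2.1] M.+1 N.+1 t.2.2) ->
  N < x.1 < n /\ M < x.2 < n.
Proof.
case: ok2 => _ _ _ _ [wE sE] /mapP [y /rungs_range]; rewrite wE sE.
by move=> [? ? ? ?] -> /=; rewrite /n; lia.
Qed.

Lemma all_rungs_bounded : bounded (all_rungs t).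
Proof.
move=> x; rewrite mem_cat => /orP [/left_rungs_range|/right_rungs_range];
  rewrite /n; lia.
Qed.

Lemma all_rungs_chain :
  {in all_rungs t &, forall x y : nat * nat, le2 x y || le2 y x}.
Proof.
move=> x y; rewrite !mem_cat => /orP [] Hx /orP [] Hy.
- exact: rungs_chain Hx Hy.
- by move: (left_rungs_range Hx) (right_rungs_range Hy); rewrite /le2; lia.
- by move: (right_rungs_range Hx) (left_rungs_range Hy); rewrite /le2; lia.
- move: Hx Hy => /mapP [x' Hx ->] /mapP [y' Hy ->].
  by have := rungs_chain Hx Hy; rewrite /le2 /= andbC [X in _ || X]andbC.
Qed.

Let up k : 'I_(N + M).+2 + 'I_(N + M).+2 := inl (inord k).
Let lo k : 'I_(N + M).+2 + 'I_(N + M).+2 := inr (inord k).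

Lemma mem_upper x : x \in upper_arcs t -> [set up x.1; up x.2] \in tree_of t.
Proof.
move=> xt; rewrite inE mem_cat; apply/orP; left.
by apply: (map_f (@upper_edge _) (map_f ord2 xt)).
Qed.

Lemma mem_lower x : x \in lower_arcs t -> [set lo x.1; lo x.2] \in tree_of t.
Proof.
move=> xt; rewrite inE !mem_cat; apply/orP; right; apply/orP; left.
by apply: (map_f (@lower_edge _) (map_f ord2 xt)).
Qed.

Lemma mem_rung x : x \in all_rungs t -> [set up x.1; lo x.2] \in tree_of t.
Proof.
move=> xt; rewrite inE !mem_cat; apply/orP; right; apply/orP; right.
by apply: (map_f (@rung_edge _) (map_f ord2 xt)).
Qed.

Lemma tree_of_connected : connected_graph (tree_of t).
Proof.
pose C a b : Prop := connect (adj (tree_of t)) a b.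
have Cxx a : C a a by exact: connect0.
have Csym a b : C a b -> C b a by rewrite /C connect_adjC.
have Ctrans a b c : C a b -> C b c -> C a c by exact: connect_trans.
have Cup x : x \in upper_arcs t -> C (up x.1) (up x.2).
  by move=> /mem_upper xt; apply: connect1.
have Clo x : x \in lower_arcs t -> C (lo x.1) (lo x.2).
  by move=> /mem_lower xt; apply: connect1.
have Crg x : x \in all_rungs t -> C (up x.1) (lo x.2).
  by move=> /mem_rung xt; apply: connect1.
have [r1 o1 R1 wE1 [wE1' sE1]] := ok1; have [r2 o2 R2 wE2 [wE2' sE2]] := ok2.
have [||||U1 L1] := @half_joined _ C up lo Cxx Csym Ctrans 0 0 t.1.1 t.1.2 r1 o1 R1.
- by rewrite wE1 sE1.
- by move=> x xt; apply: Cup; rewrite upper_arcsE mem_cat xt.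
- by move=> x xt; apply: Clo; rewrite lower_arcsE mem_cat xt.
- by move=> x xt; apply: Crg; rewrite mem_cat xt.
have [||||L2 U2] := @half_joined _ C lo up Cxx Csym Ctrans M.+1 N.+1 t.2.1 t.2.2 r2 o2 R2.
- by rewrite wE2 sE2.
- by move=> x xt; apply: Clo; rewrite lower_arcsE mem_cat xt orbT.
- by move=> x xt; apply: Cup; rewrite upper_arcsE mem_cat inE xt !orbT.
- move=> x xt; apply/Csym/(Crg (swap x)).
  by rewrite mem_cat; apply/orP; right; apply: map_f.
have link : C (up N.+1) (up 0).
  apply: Ctrans (U1 N _); last by rewrite wE1 add0n leqnn.
  by apply/Csym/(Cup (N, N.+1)); rewrite upper_arcsE mem_cat inE eqxx orbT.
have link' : C (lo M.+1) (up 0).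
  by apply: Ctrans link; apply/Csym/U2; rewrite leqnn leq_addr.
have all0 v : C v (up 0).
  case: v => k.
  - have -> : inl k = up k by rewrite /up inord_val.
    have := ltn_ord k; case: (leqP k N) => kN kn; first by apply: U1; rewrite wE1 add0n.
    by apply: Ctrans link'; apply: U2; rewrite wE2'; lia.
  - have -> : inr k = lo k by rewrite /lo inord_val.
    have := ltn_ord k; case: (leqP k M) => kM kn; first by apply: L1; rewrite wE1' add0n.
    by apply: Ctrans link'; apply: L2; rewrite wE2; lia.
by move=> a b; apply: (Ctrans _ _ _ (all0 a) (Csym _ _ (all0 b))).
Qed.

(** At most [N + M + 1] edges per half and one link make [2 * (N + M) + 3], against
    [2 * (N + M) + 4] vertices. *)
Lemma card_tree_of : #|tree_of t| < #|{: 'I_(N + M).+2 + 'I_(N + M).+2}|.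
Proof.
rewrite card_sum card_ord /tree_of cardsE.
apply: (leq_ltn_trans (card_size _)).
rewrite /edges !size_cat !size_map upper_arcsE lower_arcsE !size_cat size_map /=.
have [r1 o1 R1 wE1 [wE1' sE1]] := ok1; have [r2 o2 R2 wE2 [wE2' sE2]] := ok2.
set a := size (rungs _ 0 0 _); set b := size (rungs _ M.+1 N.+1 _).
have : _ + _ + a <= _ := size_half 0 0 t.1.1 o1 R1.
have : _ + _ + b <= _ := size_half M.+1 N.+1 t.2.1 o2 R2.
by rewrite wE1 wE1' wE2 wE2'; lia.
Qed.

Lemma ord2_ordered s : {in s, forall x : nat * nat, x.1 < x.2 /\ x.2 < n} ->
  {in map ord2 s, forall x : 'I_(N + M).+2 * 'I_(N + M).+2, x.1 < x.2}.
Proof.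
by move=> H _ /mapP [x /H [x12 x2] ->]; rewrite /= !inordK // (ltn_trans x12).
Qed.

Lemma tree_of_spanning : spanning_tree (tree_of t).
Proof.
have cE := tree_of_connected.
split=> //; last exact: acyclic_of_card cE card_tree_of.
move=> e; rewrite inE !mem_cat => /or3P [] /mapP [x xin ->]; rewrite cards2.
- have := ord2_ordered upper_arcs_range xin; case: eqVneq => // -[->].
  by rewrite ltnn.
- have := ord2_ordered lower_arcs_range xin; case: eqVneq => // -[->].
  by rewrite ltnn.
- by [].
Qed.

Variables (R : realType) (p : 'I_(N + M).+2 + 'I_(N + M).+2 -> point R).

Lemma tree_of_non_crossing : double_chain p -> non_crossing p (tree_of t).
Proof.
have lam w (s := arcs 0 w) : {in s, forall x : nat * nat, x.1 < x.2 /\ x.2 < n} ->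
   {in map ord2 s &, forall x y : 'I_(N + M).+2 * 'I_(N + M).+2,
        laminar (val x.1, val x.2) (val y.1, val y.2)}.
  move=> H _ _ /mapP [x xs ->] /mapP [y ys ->].
  have [x1 x2] := H x xs; have [y1 y2] := H y ys.
  rewrite -/(val2 (ord2 x)) -/(val2 (ord2 y)).
  rewrite !ord2K ?(ltn_trans x1) ?(ltn_trans y1) //.
  exact: arcs_laminar xs ys.
move=> dc; apply: edges_non_crossing => //.
- exact: ord2_ordered upper_arcs_range.
- exact: ord2_ordered lower_arcs_range.
- exact: lam upper_arcs_range.
- exact: lam lower_arcs_range.
- move=> _ _ /mapP [x xs ->] /mapP [y ys ->].
  have [x1 x2] := all_rungs_bounded xs; have [y1 y2] := all_rungs_bounded ys.
  rewrite -/(val2 (ord2 x)) -/(val2 (ord2 y)) !ord2K //.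
  exact: all_rungs_chain xs ys.
Qed.

End OneTree.

Lemma rootless_inj j w w' : rootless w -> rootless w' -> width w = width w' ->
  arcs j w =i arcs j w' -> w = w'.
Proof.
move=> rw rw' wE A.
have [] // := @word_inj pred0 w w' 0 0 j (rootless_wf rw) (rootless_wf rw') wE A.
  by move=> x; rewrite !rootless_rungs.
by rewrite !rootless_steps.
Qed.

Lemma tree_of_inj t t' : half_ok t.1 -> half_ok t.2 -> half_ok t'.1 ->
  half_ok t'.2 -> tree_of t = tree_of t' -> t = t'.
Proof.
move=> ok1 ok2 ok1' ok2' E.
have [] := @mem_edges _ (map ord2 (upper_arcs t)) (map ord2 (lower_arcs t))
  (map ord2 (all_rungs t)) (map ord2 (upper_arcs t')) (map ord2 (lower_arcs t'))
  (map ord2 (all_rungs t')).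
- exact: ord2_ordered (upper_arcs_range ok1 ok2).
- exact: ord2_ordered (lower_arcs_range ok1 ok2).
- exact: ord2_ordered (upper_arcs_range ok1' ok2').
- exact: ord2_ordered (lower_arcs_range ok1' ok2').
- by move=> e; move/setP/(_ e): E; rewrite !inE.
have bd s : {in s, forall x : nat * nat, x.1 < x.2 /\ x.2 < n} -> bounded s.
  by move=> H x /H [x1 x2]; split=> //; apply: ltn_trans x2.
move=> /(map_ord2_inj (bd _ (upper_arcs_range ok1 ok2))
           (bd _ (upper_arcs_range ok1' ok2'))) EU.
move=> /(map_ord2_inj (bd _ (lower_arcs_range ok1 ok2))
           (bd _ (lower_arcs_range ok1' ok2'))) EL.
move=> /(map_ord2_inj (all_rungs_bounded ok1 ok2) (all_rungs_bounded ok1' ok2')) ES.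
have [r1 o1 R1 wE1 [wE1' sE1]] := ok1; have [r2 o2 R2 wE2 [wE2' sE2]] := ok2.
have [q1 u1 Q1 vE1 [vE1' tE1]] := ok1'; have [q2 u2 Q2 vE2 [vE2' tE2]] := ok2'.
rewrite !upper_arcsE // in EU; rewrite !lower_arcsE // in EL.
have lo w b : width w = b -> all (fun x : nat * nat => x.2 <= b) (arcs 0 w).
  by move=> wE; apply/allP => x /arcs_range; rewrite wE => -[].
have hi w b : all (predC (fun x : nat * nat => x.2 <= b)) (arcs b.+1 w).
  by apply/allP => x /arcs_range [x1 x2 _]; rewrite /= -ltnNge (ltn_trans x1).
have hi' w : all (predC (fun x : nat * nat => x.2 <= N)) ((N, N.+1) :: arcs N.+1 w).
  by rewrite /= ltnn hi.
have [AU1 AU2] := eq_mem_split (lo _ _ wE1) (lo _ _ vE1) (hi' _) (hi' _) EU.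
have [AL1 AL2] := eq_mem_split (lo _ _ wE1') (lo _ _ vE1') (hi _ _) (hi _ _) EL.
have st w : all (predC (fun x : nat * nat => x.1 <= N)) (arcs N.+1 w).
  by apply/allP => x /arcs_range [x1 _ _]; rewrite /= -ltnNge.
have one : all (fun x : nat * nat => x.1 <= N) [:: (N, N.+1)] by rewrite /= leqnn.
have [_ {}AU2] := @eq_mem_split _ _ [:: _] _ [:: _] _ one one (st _) (st _) AU2.
have lr (s : halves) : half_ok s.1 -> all (fun x : nat * nat => x.1 <= N)
    (rungs [in heads 0 s.1.1] 0 0 s.1.2).
  by move=> ok; apply/allP => x /(left_rungs_range ok) [].
have rr (s : halves) : half_ok s.2 -> all (predC (fun x : nat * nat => x.1 <= N))
    (map swap (rungs [in heads M.+1 s.2.1] M.+1 N.+1 s.2.2)).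
  by move=> ok; apply/allP => x /(right_rungs_range ok) [/andP [h _] _]; rewrite /= -ltnNge.
have [S1 S2] := eq_mem_split (lr _ ok1) (lr _ ok1') (rr _ ok2) (rr _ ok2') ES.
have {}S2 := eq_mem_map swap S2.
have swapK s : map swap (map swap s) = s.
  by rewrite -map_comp -[RHS]map_id; apply: eq_map => -[].
rewrite !swapK in S2.
(* Arcs alone determine the rootless words. Once these agree, the rungs of both trees refer to the
   same heads, as [word_inj] requires. *)
have W1 : t.1.1 = t'.1.1 by apply: (rootless_inj r1 q1 _ AU1); rewrite wE1 vE1.
have W2 : t.2.1 = t'.2.1 by apply: (rootless_inj r2 q2 _ AL2); rewrite wE2 vE2.
rewrite -W1 in S1; rewrite -W2 in S2.
have [||_ w1] := word_inj (one_root_wf o1) (one_root_wf u1) _ AL1 S1.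
- by rewrite wE1' vE1'.
- by rewrite sE1 tE1.
have [||_ w2] := word_inj (one_root_wf o2) (one_root_wf u2) _ AU2 S2.
- by rewrite wE2' vE2'.
- by rewrite sE2 tE2.
move: W1 W2 w1 w2; clear.
by case: t t' => [[? ?] [? ?]] [[? ?] [? ?]] /= -> -> -> ->.
Qed.

Lemma nb_trees_ge (R : realType) (p : 'I_(N + M).+2 + 'I_(N + M).+2 -> point R)
    (A B : seq word) :
  double_chain p -> uniq A -> uniq B ->
  {in A, forall w, rootless w && (width w == N)} ->
  {in B, forall w, [&& one_root w && rooted w, width w == M & steps w == N]} ->
  size A * size B * (size A * size B) <= nb_nc_spanning_trees p.
Proof.
move=> dc uA uB okA okB.
pose h := [seq (W, w) | W <- A, w <- B].
pose s := [seq (x, y) | x <- h, y <- h].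
have hok x : x \in h -> half_ok x.
  case/allpairsP => -[W w] /= [/okA /andP [r /eqP wE]].
  move=> /okB /and3P [/andP [o ro] /eqP wE' /eqP sE] ->.
  by split.
have sok x : x \in s -> half_ok x.1 /\ half_ok x.2.
  by case/allpairsP => -[x1 x2] /= [/hok ? /hok ? ->].
have uh : uniq h by apply: allpairs_uniq => // -[? ?] [? ?] _ _ [-> ->].
have us : uniq s by apply: allpairs_uniq => // -[? ?] [? ?] _ _ [-> ->].
have <- : size s = size A * size B * (size A * size B) by rewrite !size_allpairs.
have uf : uniq (map tree_of s).
  rewrite map_inj_in_uniq // => x y /sok [x1 x2] /sok [y1 y2].
  exact: tree_of_inj.
rewrite -(size_map tree_of) -(card_uniqP uf) /nb_nc_spanning_trees.
apply/subset_leq_card/subsetP => E /mapP [t /sok [t1 t2] ->].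
rewrite inE; apply/asboolP; split; first exact: tree_of_spanning.
exact: tree_of_non_crossing.
Qed.

End Assembly.

Lemma iter_arc_inj r : injective (iter r (Arc Eps Eps)).
Proof. by elim: r => // r IH w w' /= [/IH]. Qed.

(** Padding uses edges in front, which extend the rooted first component; a [Bar] there would leave
    the new first component without a root. *)
Lemma iter_arc_ok r w m i :
  [&& one_root w && rooted w, width w == m & steps w == i] ->
  let w' := iter r (Arc Eps Eps) w in
  [&& one_root w' && rooted w', width w' == (m + r)%N & steps w' == i].
Proof.
move=> /and3P [/andP [ow rw] /eqP ww /eqP sw].
elim: r => [|r /and3P [/andP [o' r'] /eqP w' /eqP s']] /=.
  by rewrite ow rw ww sw addn0 !eqxx.
by rewrite o' r' w' s' addnS !eqxx.
Qed.

Lemma one_root_rooted_append w v : one_root w && rooted w ->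
  one_root v && rooted v ->
  one_root (append w (Bar v)) && rooted (append w (Bar v)).
Proof.
by move=> /andP [ow rw] /andP [ov rv]; have [-> ->] := one_root_append ow ov rv.
Qed.

Local Open Scope ring_scope.

Theorem theorem1 (R : realType) :
  exists2 c : R, 0 < c &
  exists n0 : nat, forall n : nat, (n0 <= n)%N ->
  forall p : 'I_n + 'I_n -> point R, double_chain p ->
  c * (1252 / 100) ^+ (2 * n) <= (nb_nc_spanning_trees p)%:R.
Proof.
have [c c0 free] := many_rootless R.
have [m [i [l [ul lP lbig]]]] := many_rooted R.
have -> : 1252 / 100 = 313 / 25 :> R by lra.
have g0 : 0 < 313 / 25 :> R by lra.
have g1 : 1 <= 313 / 25 :> R by lra.
(* In a half, a block takes [m.+1] points of one chain and [i] of the other. *)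
set q := (m.+1 + i)%N.
(* The denominator pays for the at most [q] leftover points of each half. *)
exists (c ^+ 2 / (313 / 25) ^+ (2 * q)).
  by rewrite divr_gt0 // exprn_gt0.
exists q.+1 => n qn p dc.
(* A half has [n = N + M + 2] points; [k.+1] blocks, including the padded one, and the [r] extra
   points account for [N + M + 1] of them. *)
pose k := (n.-1 %/ q).-1; pose r := (n.-1 %% q)%N.
(* The lower word is a product of [k.+1] words, padded with [r] extra points;
   the upper word must have as many slots as the path has steps. *)
pose N := (k.+1 * i)%N; pose M := (k * m.+1 + (m + r))%N.
have q0 : (0 < q)%N by [].
have kE : (n.-1 = k.+1 * q + r)%N.
  rewrite /k prednK; first exact: divn_eq.
  by rewrite divn_gt0 // -ltnS prednK // (leq_trans _ qn).
have nE : n = (N + M).+2.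
  have : n.-1.+1 = n by rewrite prednK // (leq_trans _ qn).
  by rewrite kE /N /M /q; nia.
have rq : (r.+1 <= q)%N by apply: ltn_pmod.
have nq : (2 * n <= 2 * (k.+1 * q) + 2 * q)%N by rewrite nE /N /M /q in rq *; nia.
clearbody k r; clear kE qn; move: p dc nq; rewrite nE => p dc nq.
have [A [uA AP Abig]] := free N.
have ub : uniq (map (iter r (Arc Eps Eps)) l).
  by rewrite map_inj_uniq //; apply: iter_arc_inj.
have [|uB sB BP] := @powerP (fun w => one_root w && rooted w) l _ m i (m + r) i k
    one_root_rooted_append ul ub lP.
  by move=> _ /mapP [w /lP wl ->]; apply: iter_arc_ok.
rewrite size_map -expnSr in sB.
have := nb_trees_ge dc uA uB AP; set B := power _ _ _ in sB BP *.
have {}BP : {in B, forall w,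
    [&& one_root w && rooted w, width w == M & steps w == N]}.
  by move=> w /BP; rewrite /N mulSnr.
move=> /(_ BP) H.
apply: (@le_trans _ _ (size A * size B * (size A * size B))%N%:R); last first.
  by rewrite ler_nat.
have AB : c * (313 / 25) ^+ (k.+1 * q) <= (size A * size B)%N%:R.
  rewrite natrM sB natrX.
  apply: (@le_trans _ _ (c * (163 / 20) ^+ N *
      ((313 / 25) ^+ m.+1 * (1252 / 815) ^+ i) ^+ k.+1)).
    rewrite -mulrA ler_pM2l // le_eqVlt; apply/orP; left; apply/eqP.
    rewrite /N !(mulnC k.+1) !exprM -exprMn; congr (_ ^+ _).
    (* As [163 / 20 * (1252 / 815) = 313 / 25], a step together with its slot in the rootless word
       is worth 12.52, like a point of the rooted word. *)
    have -> : (313 / 25) ^+ q = (313 / 25) ^+ m.+1 *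
        ((163 / 20) ^+ i * (1252 / 815) ^+ i) :> R.
      by rewrite /q exprD -exprMn; congr (_ * _ ^+ _); lra.
    by rewrite mulrCA.
  apply: ler_pM => //.
  - by rewrite mulr_ge0 ?exprn_ge0 //; [exact: ltW|lra].
  - by rewrite exprn_ge0 // mulr_ge0 // exprn_ge0 //; lra.
  - by rewrite lerXn2r ?nnegrE // mulr_ge0 // exprn_ge0 //; lra.
rewrite natrM mulrAC ler_pdivrMr ?exprn_gt0 //.
apply: (@le_trans _ _ (c ^+ 2 * (313 / 25) ^+ (2 * (k.+1 * q) + 2 * q))).
  by rewrite ler_pM2l ?exprn_gt0 // ler_weXn2l.
rewrite exprD mulrA ler_pM2r ?exprn_gt0 //.
rewrite mulnC exprM -exprMn expr2.
have h : 0 <= c * (313 / 25) ^+ (k.+1 * q).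
  by rewrite mulr_ge0 ?exprn_ge0 // ltW.
exact: ler_pM.
Qed.
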